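(* Let $X$ be a Hilbert space, $U$ a Banach space, $B\in L(U,X)$, and let $A:D(A)\subset X\to X$ generate an exponentially stable strongly continuous semigroup $T=(T(t))_{t\ge 0}$ on $X$. The following statements are equivalent: (i) There exists a coercive, quadratic $L^2$-ISS Lyapunov function for $\Sigma(A,B)$. (ii) There exists a coercive, quadratic Lyapunov function for $\Sigma(A,0)$. (iii) There exists an equivalent scalar product $\langle\cdot,\cdot\rangle_{new}$ on $X$ such that $A$ is dissipative with respect to it, i.e. $\mathrm{Re}\,\langle Ax,x\rangle_{new}\le 0$ for all $x\in D(A)$, and $x\mapsto \langle x,x\rangle_{new}=\|x\|_{new}^2$ is a quadratic ISS Lyapunov function for $\Sigma(A,B)$. (iv) There exists an equivalent scalar product $\langle\cdot,\cdot\rangle_{new}$ on $X$ such that $A$ is dissipative with respect to it, i.e. $\mathrm{Re}\,\langle Ax,x\rangle_{new}\le 0$ for all $x\in D(A)$. (v) $T$ is similar to a contraction semigroup. (vi) There are an equivalent norm $W$ on $X$ of the form $W(x)=\|Fx\|$ with $F\in L(X)$, and a constant $a>0$, such that $\dot W(x)\le -a\,W(x)$ for all $x\in X$ for the system with $B=0$, i.e. $\limsup_{h\to 0^+}\frac1h\big(W(T(h)x)-W(x)\big)\le -a\,W(x)$.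
   Context: $L(X,Y)$ denotes the bounded linear operators from $X$ to $Y$, and $L(X):=L(X,X)$. $\mathcal K_\infty$ is the set of continuous, strictly increasing functions $\theta:[0,\infty)\to[0,\infty)$ with $\theta(0)=0$ and $\lim_{r\to\infty}\theta(r)=\infty$. For $B\in L(U,X)$, $\Sigma(A,B)$ denotes the system $\dot x(t)=Ax(t)+Bu(t)$, $x(0)=x_0$, with mild solution $\phi(t,x_0,u)=T(t)x_0+\int_0^t T(t-s)Bu(s)\,ds$. For $V:X\to[0,\infty)$ put $\dot V_u(x):=\limsup_{h\to0^+}\frac1h\big(V(\phi(h,x,u))-V(x)\big)$. ISS Lyapunov function for $\Sigma(A,B)$: a continuous $V:X\to[0,\infty)$ for which there exist $\alpha_2,\alpha_3,\sigma\in\mathcal K_\infty$ with $0<V(x)\le\alpha_2(\|x\|)$ for all $x\ne0$, and $\dot V_u(x)\le-\alpha_3(\|x\|)+\sigma\big(\limsup_{t\to0^+}\|u\|_{L^\infty(0,t)}\big)$ for all $x\in X$ and all $u\in L^\infty_{loc}(0,\infty;U)$. It is coercive if there is $\alpha_1\in\mathcal K_\infty$ with $\alpha_1(\|x\|)\le V(x)$ for all $x\in X$. It is quadratic if there is a self-adjoint $P\in L(X)$ with $V(x)=\langle Px,x\rangle$ for all $x$ (equivalently, if there is $F\in L(X)$ with $V(x)=\|Fx\|^2$ for all $x$). A (coercive, quadratic) Lyapunov function for $\Sigma(A,0)$ is a (coercive, quadratic) ISS Lyapunov function for the system with $B=0$. Quadratic $L^2$-ISS Lyapunov function for $\Sigma(A,B)$: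 a continuous $V:X\to[0,\infty)$ of the form $V(x)=\|Fx\|^2$ with an injective $F\in L(X)$, such that there is $\alpha_2\in\mathcal K_\infty$ with $0<V(x)\le\alpha_2(\|x\|)$ for $x\neq0$, and there are $a_3,a_4>0$ with $\dot V_u(x)\le-a_3\|x\|^2+a_4\|u(0)\|_U^2$ for all $x\in X$ and all $u\in C([0,\infty),U)$. It is coercive if there are $a_1,a_2>0$ with $a_1\|x\|^2\le V(x)\le a_2\|x\|^2$ for all $x\in X$. An equivalent scalar product on $X$ is a scalar product $\langle\cdot,\cdot\rangle_{new}$ whose induced norm $\|\cdot\|_{new}=\sqrt{\langle\cdot,\cdot\rangle_{new}}$ is equivalent to $\|\cdot\|$. $T$ is similar to a contraction semigroup if there is a boundedly invertible $S:X\to X$ such that $(ST(t)S^{-1})_{t\ge0}$ is a contraction semigroup. *)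

(* Defs.v *)
From HB Require Import structures.
From mathcomp Require Export all_boot all_order all_algebra.
From mathcomp Require Export complex.
From mathcomp Require Export all_classical all_reals all_analysis.

Set Implicit Arguments.
Unset Strict Implicit.
Unset Printing Implicit Defensive.

Export Order.TTheory GRing.Theory Num.Theory.
Export numFieldNormedType.Exports.

Local Open Scope classical_set_scope.
Local Open Scope ring_scope.

(* The scalar field is the field of real numbers or that of complex numbers. *)
Variant scalars := RealScalars | ComplexScalars.

Definition sfield (R : realType) (k : scalars) : numFieldType :=
  match k with RealScalars => R | ComplexScalars => R[i] end.

Section Scalars.
Context {R : realType} {k : scalars}.

Definition re : sfield R k -> R :=
  match k return sfield R k -> R with
  | RealScalars => fun z => z
  | ComplexScalars => fun z => complex.Re z
  end.

Definition conjs : sfield R k -> sfield R k :=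
  match k return sfield R k -> sfield R k with
  | RealScalars => fun z => z
  | ComplexScalars => fun z => conjc z
  end.

Definition ofR : R -> sfield R k :=
  match k return R -> sfield R k with
  | RealScalars => fun r => r
  | ComplexScalars => fun r => (r%:C)%C
  end.

(* The library's norm on a normed module over [sfield R k] takes its
   (nonnegative real) values in [sfield R k]. *)
Definition nrm {V : normedModType (sfield R k)} (x : V) : R := re `|x|.

End Scalars.

Section Bochner.
Context {R : realType} {k : scalars} {d : measure_display}
  {Om : measurableType d} (mu : {measure set Om -> \bar R})
  {V : normedModType (sfield R k)}.
Implicit Types (D : set Om) (f s : Om -> V).

Definition simple_on D s :=
  finite_set (s @` D) /\ forall y, measurable (D `&` s @^-1` [set y]).

Definition strongly_measurable D f :=
  exists s_ : nat -> Om -> V, (forall n, simple_on D (s_ n)) /\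
    {ae mu, forall w, D w -> s_ ^~ w @ \oo --> f w}.

Definition integrable_simple_on D s :=
  simple_on D s /\
  forall y, y != 0 -> (mu (D `&` s @^-1` [set y]) < +oo)%E.

Definition simple_integral D s : V :=
  \sum_(y \in s @` D) ofR (fine (mu (D `&` s @^-1` [set y]))) *: y.

(* [nrm (f w - s_ n w)] need only be almost everywhere equal to a measurable
   function; the library's integral of a nonnegative function is the supremum of
   the integrals of the simple functions below it, so null sets do not matter. *)
Definition is_bochner_integral D f (v : V) :=
  strongly_measurable D f /\
  exists s_ : nat -> Om -> V,
    [/\ forall n, integrable_simple_on D (s_ n),
        (\int[mu]_(w in D) (nrm (f w - s_ n w))%:E)%E @[n --> \oo] --> 0%E &
        simple_integral D (s_ n) @[n --> \oo] --> v].

(* Equal to 0 when [f] is not Bochner integrable on [D]. *)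
Definition bochner_integral D f : V := xget 0 [set v | is_bochner_integral D f v].

End Bochner.

Section Operators.
Context {R : realType} {k : scalars}.
Implicit Types X Y U : normedModType (sfield R k).

(* For linear [f] this is boundedness in operator norm
   (see [linear_boundedP]). *)
Definition bounded_op X Y (f : X -> Y) := bounded_near f (nbhs (0 : X)).

(* In the next definitions only the values [T t] with [0 <= t] matter. *)
Definition C0_semigroup X (T : R -> {linear X -> X}) :=
  [/\ forall t, 0 <= t -> bounded_op (T t),
      forall x, T 0 x = x,
      forall t s, 0 <= t -> 0 <= s -> forall x, T (t + s) x = T t (T s x) &
      forall x, T t x @[t --> 0^'+] --> x].

Definition contraction_semigroup X (T : R -> {linear X -> X}) :=
  C0_semigroup T /\ forall t, 0 <= t -> forall x, nrm (T t x) <= nrm x.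

Definition exponentially_stable X (T : R -> {linear X -> X}) :=
  exists M w : R, [/\ 0 < M, 0 < w &
    forall t, 0 <= t -> forall x, nrm (T t x) <= M * expR (- (w * t)) * nrm x].

(* The unbounded operator with domain [DA] is represented by a total function
   [A] whose values outside [DA] are irrelevant. *)
Definition generates X (DA : set X) (A : X -> X) (T : R -> {linear X -> X}) :=
  let quotient x h := ofR h^-1 *: (T h x - x) in
  (forall x, DA x <-> cvg (quotient x h @[h --> 0^'+])) /\
  (forall x, DA x -> quotient x h @[h --> 0^'+] --> A x).

Definition similar_to_contraction X (T : R -> {linear X -> X}) :=
  exists S S' : {linear X -> X},
    [/\ bounded_op S, bounded_op S', cancel S S', cancel S' S &
        contraction_semigroup (fun t => S \o T t \o S')].

(* Upper right Dini derivative at 0 of a real function extending [g] by the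
   value [g0] at 0. *)
Definition dini (g : R -> R) (g0 : R) : \bar R :=
  limf_esup (fun h : R => (h^-1 * (g h - g0))%:E) (0 : R)^'+.

Definition mild_solution X U (T : R -> {linear X -> X}) (B : U -> X)
    (t : R) (x0 : X) (u : R -> U) : X :=
  T t x0 + bochner_integral lebesgue_measure `]0, t[ (fun s => T (t - s) (B (u s))).

Definition Vdot X U (T : R -> {linear X -> X}) (B : U -> X) (V : X -> R)
    (u : R -> U) (x : X) : \bar R :=
  dini (fun h => V (mild_solution T B h x u)) (V x).

Definition Linfty_norm U (u : R -> U) (t : R) : \bar R :=
  'N[lebesgue_measure]_+oo [(fun s : R => (nrm (u s))%:E) \_ `]0, t[].

(* "Locally" refers to bounded subintervals of (0, oo), with 0 as an admissible
   endpoint, so that the mild solution is defined. *)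
Definition Linfty_loc U (u : R -> U) :=
  strongly_measurable lebesgue_measure `]0, +oo[ u /\
  forall t, 0 < t -> (Linfty_norm u t < +oo)%E.

Definition Linfty_norm0 U (u : R -> U) : R :=
  fine (limf_esup (Linfty_norm u) (0 : R)^'+).

Definition class_Kinfty (theta : R -> R) :=
  [/\ {within `[0, +oo[, continuous theta},
      {in `[0, +oo[ &, {homo theta : r s / r < s}},
      theta 0 = 0 &
      theta r @[r --> +oo] --> +oo].

Definition ISS_Lyapunov X U (T : R -> {linear X -> X}) (B : U -> X)
    (V : X -> R) :=
  [/\ continuous V, forall x, 0 <= V x &
   exists alpha2 alpha3 sigma : R -> R,
   [/\ class_Kinfty alpha2, class_Kinfty alpha3, class_Kinfty sigma,
       forall x, x != 0 -> 0 < V x <= alpha2 (nrm x) &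
       forall (x : X) (u : R -> U), Linfty_loc u ->
         (Vdot T B V u x <=
           (- alpha3 (nrm x) + sigma (Linfty_norm0 u))%:E)%E]].

Definition coercive X (V : X -> R) :=
  exists alpha1, class_Kinfty alpha1 /\ forall x, alpha1 (nrm x) <= V x.

Definition L2_ISS_quadratic_Lyapunov X U (T : R -> {linear X -> X})
    (B : U -> X) (V : X -> R) :=
  [/\ continuous V,
   exists F : {linear X -> X},
     [/\ bounded_op F, injective F & forall x, V x = nrm (F x) ^+ 2],
   exists alpha2, class_Kinfty alpha2 /\
     forall x, x != 0 -> 0 < V x <= alpha2 (nrm x) &
   exists a3 a4 : R, [/\ 0 < a3, 0 < a4 &
     forall (x : X) (u : R -> U), {within `[0, +oo[, continuous u} ->
       (Vdot T B V u x <= (- (a3 * nrm x ^+ 2) + a4 * nrm (u 0) ^+ 2)%:E)%E]].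

Definition L2_coercive X (V : X -> R) :=
  exists a1 a2 : R, [/\ 0 < a1, 0 < a2 &
    forall x, a1 * nrm x ^+ 2 <= V x <= a2 * nrm x ^+ 2].

Definition norm_equiv X (W : X -> R) :=
  exists c C : R, [/\ 0 < c, 0 < C &
    forall x, c * nrm x <= W x <= C * nrm x].

Definition equivalent_norm X (W : X -> R) :=
  [/\ forall x y, W (x + y) <= W x + W y,
      forall (a : sfield R k) x, W (a *: x) = re `|a| * W x &
      norm_equiv W].

(* The library's forms are linear in the first argument and conjugate-linear
   in the second. *)
Definition induces_norm X (ip : {dot X for conjs}) :=
  forall x : X, ip x x = `|x| ^+ 2.

Definition quadratic X (ip : {dot X for conjs}) (V : X -> R) :=
  exists P : {linear X -> X},
    [/\ bounded_op P, forall x y, ip (P x) y = ip x (P y) &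
        forall x, ip (P x) x = ofR (V x)].

Definition equivalent_scalar_product X (ipn : {dot X for conjs}) :=
  norm_equiv (fun x : X => Num.sqrt (re (ipn x x))).

Definition dissipative X (ipn : {dot X for conjs}) (DA : set X) (A : X -> X) :=
  forall x, DA x -> re (ipn (A x) x) <= 0.

End Operators.

(* Main.v *)
From HB Require Import structures.
Require Import Defs.
From mathcomp Require Import ring lra measurable_realfun ess_sup_inf hoelder.

Set Implicit Arguments.
Unset Strict Implicit.
Unset Printing Implicit Defensive.

Local Open Scope classical_set_scope.
Local Open Scope ring_scope.

(** Quadratic Lyapunov functions, equivalent scalar products and similarity
transforms all carry the same data, namely a bounded coercive Hermitian form
on X: by the Riesz theorem such a form is the scalar product composed with a
bounded self-adjoint operator ([hform_operator]), and by the square root of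
that operator it is x |-> |F x|^2 for a boundedly invertible F
([hform_square_root]). What remains is to move decay information between the
statements.

(i) => (ii). The input u = 0 turns the estimate of (i) into the decay of V
along the unforced orbits.

(ii) => (iii). V is quadratic, so both its lower bound and its decay rate can
be rescaled from the unit sphere: al1 1 * |x|^2 <= V x, and V decays at rate
al3 1 * |x|^2. Hence V is the square of an equivalent Hilbert norm, and its
right derivative 2 Re <A x, x>_new along an orbit starting in D(A) is at most
0. An input u moves the state by at most a multiple of h |u| in time h, which
raises V by at most a multiple of h |x| |u|, up to terms of second order in h;
half of the decay rate absorbs this, up to a multiple of |u|^2
([dini_forced]).

(iv) => (v). Dissipativity gives information only on D(A), so the density of
D(A) is needed. The averages of an orbit over [0, t] lie in D(A)
([weak_integral_domain]); they are defined weakly, through the Riesz theorem,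
so that only integrals of continuous real functions occur. On D(A) the
estimate |T (s + h) x|_new^2 <= |T s x|_new^2 + h e holds for small h uniformly
in s, and adding up n steps of length t / n shows that T is a contraction
semigroup for the new norm ([dissipative_contraction]). If |x|_new = |F x|,
then F conjugates T to a contraction semigroup for the original norm.

(v) => (vi). If S conjugates T to contractions, then |S x|^2 is nonincreasing
along orbits. Adding the integral of |T s x|^2 over [0, tau] contributes the
derivative |T tau x|^2 - |x|^2, which is at most - |x|^2 / 2 once tau is so
large that stability makes |T tau x| <= |x| / 2. The sum is a coercive form
and its square root is the required W.

(vi) => (i). Squaring W doubles the rate, and [dini_forced] adds the input.

Inputs are controlled without any integrability statement: the norm of a
Bochner integral is bounded by the essential bound of the integrand times the
measure of the domain, also when the integral is 0 by convention
([nrm_bochner_le]). *)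

(** * The scalar field and real-valued norms *)

Section ScalarField.
Context {R : realType} {k : scalars}.
Implicit Types (z w : sfield R k) (r s : R).

Lemma reD z w : re (z + w) = re z + re w.
Proof. by case: k z w => // -[a b] [c d]. Qed.

Lemma reN z : re (- z) = - re z.
Proof. by case: k z => // -[a b]. Qed.

Lemma re0 : re (0 : sfield R k) = 0.
Proof. by case: k. Qed.

Lemma ofRK : cancel (@ofR R k) re.
Proof. by case: k. Qed.

Lemma ofRD r s : ofR (r + s) = ofR r + ofR s :> sfield R k.
Proof. by case: k => //=; rewrite rmorphD. Qed.

Lemma ofRM r s : ofR (r * s) = ofR r * ofR s :> sfield R k.
Proof. by case: k => //=; rewrite rmorphM. Qed.

Lemma ofR1 : ofR 1 = 1 :> sfield R k.
Proof. by case: k. Qed.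

Lemma ofR0 : ofR 0 = 0 :> sfield R k.
Proof. by case: k. Qed.

Lemma ofRN r : ofR (- r) = - ofR r :> sfield R k.
Proof. by case: k => //=; rewrite rmorphN. Qed.

Lemma re_ofRM r z : re (ofR r * z) = r * re z.
Proof. by case: k z => //= -[a b] /=; rewrite mul0r subr0. Qed.

Lemma ler_ofR r s : (ofR r <= ofR s :> sfield R k) = (r <= s).
Proof. by case: k => //=; rewrite lecR. Qed.

Lemma ltr_ofR r s : (ofR r < ofR s :> sfield R k) = (r < s).
Proof. by case: k => //=; rewrite ltcR. Qed.

Lemma real_ofR z : z \is Num.real -> z = ofR (re z).
Proof.
case: k z => //= -[a b] /=.
by rewrite realE !lecE /= => /orP[] /andP[/eqP]; [move=> ->|move=> <-].
Qed.

Lemma normr_ofR r : `|ofR r : sfield R k| = ofR `|r|.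
Proof. by case: k => //=; rewrite normc_def /= expr0n addr0 sqrtr_sqr. Qed.

Lemma normr_re z : `|z| = ofR (re `|z|).
Proof. by apply: real_ofR; rewrite normr_real. Qed.

Lemma re_normr_ge0 z : 0 <= re `|z|.
Proof. by rewrite -ler_ofR -normr_re ofR0. Qed.

Lemma conjsK : involutive (@conjs R k).
Proof. by case: k => //=; exact: conjcK. Qed.

Lemma re_conjs z : re (conjs z) = re z.
Proof. by case: k z => // -[a b]. Qed.

Lemma conjsD z w : conjs (z + w) = conjs z + conjs w.
Proof. by case: k z w => //= *; rewrite rmorphD. Qed.

Lemma conjsN z : conjs (- z) = - conjs z.
Proof. by case: k z => //= *; rewrite rmorphN. Qed.

Lemma conjsM z w : conjs (z * w) = conjs z * conjs w.
Proof. by case: k z w => //= *; rewrite rmorphM. Qed.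

Lemma conjs_ofR r : conjs (ofR r) = ofR r :> sfield R k.
Proof. by case: k => //=; rewrite /conjc /= oppr0. Qed.

Lemma conjs_fixed_real z : conjs z = z -> z = ofR (re z).
Proof.
case: k z => [//|[a b]] [] /= h; congr Complex; lra.
Qed.

(** In the complex case, re (i z) is minus the imaginary part of z. *)
Lemma scalar_eq_re z w : (forall a, re (a * z) = re (a * w)) -> z = w.
Proof.
case: k z w => [z w /(_ 1)|[a b] [c d] H]; first by rewrite !mul1r.
have := H 1; have := H (Complex 0 1); rewrite !mul1r /= !mul0r !mul1r !sub0r.
by move=> /oppr_inj -> ->.
Qed.

End ScalarField.

Section Norm.
Context {R : realType} {k : scalars}.
Implicit Types X Y : normedModType (sfield R k).

Lemma ofR_nrm X (x : X) : ofR (nrm x) = `|x|.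
Proof. by rewrite /nrm -real_ofR// normr_real. Qed.

Lemma nrm_ge0 X (x : X) : 0 <= nrm x.
Proof. by rewrite -(@ler_ofR R k) ofR_nrm ofR0. Qed.

Lemma nrmD X (x y : X) : nrm (x + y) <= nrm x + nrm y.
Proof. by rewrite -(@ler_ofR R k) ofRD !ofR_nrm ler_normD. Qed.

Lemma nrmZ X (a : sfield R k) (x : X) : nrm (a *: x) = re `|a| * nrm x.
Proof. by rewrite /nrm normrZ [`|a| in LHS]normr_re re_ofRM. Qed.

Lemma nrmZR X (r : R) (x : X) : nrm (ofR r *: x) = `|r| * nrm x.
Proof. by rewrite nrmZ normr_ofR ofRK. Qed.

Lemma nrmN X (x : X) : nrm (- x) = nrm x.
Proof. by rewrite /nrm normrN. Qed.

Lemma nrm0 X : nrm (0 : X) = 0.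
Proof. by rewrite /nrm normr0 re0. Qed.

Lemma nrmC X (x y : X) : nrm (x - y) = nrm (y - x).
Proof. by rewrite -nrmN opprB. Qed.

Lemma nrmB X (x y : X) : nrm (x - y) <= nrm x + nrm y.
Proof. by rewrite -(nrmN y) nrmD. Qed.

Lemma nrm_eq0 X (x : X) : nrm x = 0 -> x = 0.
Proof. by move=> H; apply/eqP; rewrite -normr_eq0 -ofR_nrm H ofR0. Qed.

Lemma nrm_gt0 X (x : X) : x != 0 -> 0 < nrm x.
Proof. by move=> x0; rewrite -(@ltr_ofR R k) ofR_nrm ofR0 normr_gt0. Qed.

Lemma cvg_nrmP X {T : Type} (F : set_system T) {FF : Filter F} (f : T -> X) (l : X) :
  f @ F --> l <-> forall e : R, 0 < e -> \forall t \near F, nrm (f t - l) < e.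
Proof.
split=> [/cvgrPdist_lt H e e0|H].
  have /H : 0 < ofR e :> sfield R k by rewrite -ofR0 ltr_ofR.
  by apply: filterS => t; rewrite -ofR_nrm ltr_ofR nrmC.
apply/cvgrPdist_lt => e e0.
have er : e = ofR (re e) by apply: real_ofR; rewrite gtr0_real.
move: e0; rewrite er -ofR0 ltr_ofR => /H.
by apply: filterS => t; rewrite -ofR_nrm ltr_ofR nrmC.
Qed.

Lemma bounded_opP X Y (f : {linear X -> Y}) :
  bounded_op f <-> exists M : R, 0 < M /\ forall x, nrm (f x) <= M * nrm x.
Proof.
rewrite /bounded_op linear_boundedP; split.
  move=> /pinfty_ex_gt0 [M M0 H].
  have Mr : M = ofR (re M) by apply: real_ofR; rewrite gtr0_real.
  exists (re M); rewrite -(@ltr_ofR R k) ofR0 -Mr; split=> // x.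
  by rewrite -(@ler_ofR R k) ofRM -Mr !ofR_nrm.
move=> [M [M0 H]]; exists (ofR M); split.
  by rewrite ger0_real// -ofR0 ler_ofR ltW.
move=> r Mr x; apply: le_trans (ler_wpM2r (normr_ge0 x) (ltW Mr)).
by rewrite -!ofR_nrm -ofRM ler_ofR.
Qed.

Lemma exists_linear X Y (f : X -> Y) : linear f -> exists g : {linear X -> Y}, g =1 f.
Proof.
move=> lf; pose m := GRing.isLinear.Build _ _ _ _ f lf.
by exists (HB.pack f m : {linear X -> Y}).
Qed.

Lemma geo_lt (C q e : R) : 0 <= C -> 0 <= q < 1 -> 0 < e ->
  exists N, forall n, (N <= n)%N -> C * q ^+ n < e.
Proof.
move=> C0 /andP[q0 q1] e0.
have : (C * q ^+ n) @[n --> \oo] --> C * 0.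
  by apply: cvgMr; apply: cvg_expr; rewrite ger0_norm.
rewrite mulr0 => /cvgr0Pnorm_lt /(_ _ e0) [N _ H].
exists N => n Nn; have := H n Nn; exact: le_lt_trans (ler_norm _).
Qed.

End Norm.

Section Complete.
Context {R : realType} {k : scalars} {X : completeNormedModType (sfield R k)}.

Lemma cauchy_nrm (u : nat -> X) :
  (forall e : R, 0 < e -> exists N, forall m n, (N <= m)%N -> (N <= n)%N ->
     nrm (u m - u n) < e) ->
  exists l, forall e : R, 0 < e -> exists N, forall n, (N <= n)%N -> nrm (u n - l) < e.
Proof.
move=> H.
have : cvg (u n @[n --> \oo]).
  apply/cauchy_cvgP; apply: cauchy_exP => e e0.
  have er : e = ofR (re e) by apply: real_ofR; rewrite gtr0_real.
  move: e0; rewrite er -ofR0 ltr_ofR => /H [N HN].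
  exists (u N), N => // n /= Nn.
  by rewrite -ball_normE /ball_ /= -ofR_nrm ltr_ofR HN//.
move=> /cvg_ex [l /cvg_nrmP ul]; exists l => e /ul [N _ HN]; exists N => n; exact: HN.
Qed.

(** Quantitative form of the completeness argument used by fixed-point
iterations: the limit inherits the geometric error bound. *)
Lemma geometric_lim (u : nat -> X) (C q : R) : 0 <= q < 1 ->
  (forall n, nrm (u n.+1 - u n) <= C * q ^+ n) ->
  exists l, forall n, nrm (u n - l) <= C / (1 - q) * q ^+ n.
Proof.
move=> /andP[q0 q1] H.
have q1' : 0 < 1 - q by lra.
have C0 : 0 <= C by have := H 0%N; rewrite expr0 mulr1; apply: le_trans; rewrite nrm_ge0.
have D m n : nrm (u (n + m)%N - u n) <= C / (1 - q) * q ^+ n * (1 - q ^+ m).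
  elim: m => [|m IH]; first by rewrite addn0 subrr nrm0 expr0 subrr mulr0.
  rewrite addnS -(subrKA (u (n + m)%N)) (le_trans (nrmD _ _))//.
  apply: le_trans (lerD (H _) IH) _.
  rewrite exprD exprS [leLHS](_ : _ = C / (1 - q) * q ^+ n * (1 - q * q ^+ m)) //.
  by field; lra.
have D' m n : nrm (u (n + m)%N - u n) <= C / (1 - q) * q ^+ n.
  apply: le_trans (D m n) _; rewrite -[leRHS]mulr1 ler_wpM2l//.
    by rewrite mulr_ge0 ?exprn_ge0// divr_ge0// ltW.
  by rewrite lerBlDr lerDl exprn_ge0.
have D'' e : 0 < e -> exists N, forall n, (N <= n)%N -> C / (1 - q) * q ^+ n < e.
  by move=> e0; apply: geo_lt => //; rewrite ?divr_ge0// ?q0// ltW.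
have [l Hl] : exists l, forall e, 0 < e -> exists N, forall n, (N <= n)%N -> nrm (u n - l) < e.
  apply: cauchy_nrm => e e0; have [N HN] := D'' e e0; exists N => m n Nm Nn.
  wlog mn : m n Nm Nn / (m <= n)%N.
    by move=> W; case/orP: (leq_total m n) => ?; [|rewrite nrmC]; exact: W.
  by rewrite nrmC -(subnKC mn) (le_lt_trans (D' _ _))// HN.
exists l => n; apply/ler_addgt0Pr => e /Hl [N HN].
have HN' := ltW (HN (n + N)%N (leq_addl _ _)).
rewrite -(subrKA (u (n + N)%N)) (le_trans (nrmD _ _))// lerD//.
by rewrite nrmC D'.
Qed.

End Complete.

(** * Hermitian forms and the Riesz theorem *)

Section Forms.
Context {R : realType} {k : scalars} {X : normedModType (sfield R k)}.
Implicit Types (b : X -> X -> R) (x y z : X).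

(** The real part of a bounded Hermitian form. The form is determined by its
real part, and [hformZl] is what sesquilinearity becomes there; this treats
real and complex scalars at once. *)
Record hform b : Prop := Form {
  hformC : forall x y, b x y = b y x;
  hformDl : forall x y z, b (x + y) z = b x z + b y z;
  hformZl : forall a x y, b (a *: x) y = b x (conjs a *: y);
  hformZRl : forall (r : R) x y, b (ofR r *: x) y = r * b x y;
  hform_bounded : exists K : R, 0 < K /\ forall x y, `|b x y| <= K * nrm x * nrm y }.

Definition coercive_hform b :=
  hform b /\ exists c : R, 0 < c /\ forall x, c * nrm x ^+ 2 <= b x x.

Lemma hformDr b : hform b -> forall x y z, b x (y + z) = b x y + b x z.
Proof. by move=> fb x y z; rewrite !(hformC fb x) (hformDl fb). Qed.

Lemma hformZRr b : hform b -> forall (r : R) x y, b x (ofR r *: y) = r * b x y.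
Proof. by move=> fb r x y; rewrite !(hformC fb x) (hformZRl fb). Qed.

Lemma hformNl b : hform b -> forall x y, b (- x) y = - b x y.
Proof.
by move=> fb x y; rewrite -mulN1r -(hformZRl fb) ofRN ofR1 scaleN1r.
Qed.

Lemma hformBl b : hform b -> forall x y z, b (x - y) z = b x z - b y z.
Proof. by move=> fb x y z; rewrite (hformDl fb) (hformNl fb). Qed.

Lemma hformBr b : hform b -> forall x y z, b x (y - z) = b x y - b x z.
Proof. by move=> fb x y z; rewrite !(hformC fb x) (hformBl fb). Qed.

Lemma hform0l b : hform b -> forall y, b 0 y = 0.
Proof. by move=> fb y; rewrite -(subrr 0) (hformBl fb) subrr. Qed.

Lemma hformD b1 b2 : hform b1 -> hform b2 -> hform (fun x y => b1 x y + b2 x y).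
Proof.
move=> f1 f2; split=> [x y|x y z|a x y|r x y|].
- by rewrite (hformC f1) (hformC f2).
- by rewrite (hformDl f1) (hformDl f2) addrACA.
- by rewrite (hformZl f1) (hformZl f2).
- by rewrite (hformZRl f1) (hformZRl f2) mulrDr.
have [K1 [K10 H1]] := hform_bounded f1; have [K2 [K20 H2]] := hform_bounded f2.
exists (K1 + K2); split=> [|x y]; first exact: addr_gt0.
by rewrite (le_trans (ler_normD _ _))// !mulrDl lerD.
Qed.

Lemma hformZ (c : R) b : hform b -> hform (fun x y => c * b x y).
Proof.
move=> fb; split=> [x y|x y z|a x y|r x y|].
- by rewrite (hformC fb).
- by rewrite (hformDl fb) mulrDr.
- by rewrite (hformZl fb).
- by rewrite (hformZRl fb) mulrCA.
have [K [K0 H]] := hform_bounded fb.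
exists ((`|c| + 1) * K); split=> [|x y]; first by rewrite mulr_gt0// ltr_wpDl.
rewrite normrM -!mulrA. rewrite ler_pM// ?lerDl// mulrA; exact: H.
Qed.

Lemma hform_comp b (S : {linear X -> X}) : bounded_op S -> hform b ->
  hform (fun x y => b (S x) (S y)).
Proof.
move=> /bounded_opP [M [M0 SM]] fb; split=> [x y|x y z|a x y|r x y|].
- by rewrite (hformC fb).
- by rewrite linearD (hformDl fb).
- by rewrite !linearZ /= (hformZl fb).
- by rewrite linearZ /= (hformZRl fb).
have [K [K0 H]] := hform_bounded fb.
exists (K * M * M); split=> [|x y]; first by rewrite !mulr_gt0.
have -> : K * M * M * nrm x * nrm y = K * (M * nrm x * (M * nrm y)) by ring.
by rewrite (le_trans (H _ _))// -mulrA ler_wpM2l ?(ltW K0)// ler_pM ?nrm_ge0.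
Qed.

(** A quadratic polynomial in t that is nowhere negative has a nonpositive
discriminant; the degenerate case c = 0 forces h = 0. *)
Lemma discriminant_le (a h c : R) :
  (forall t, 0 <= a + 2 * t * h + t ^+ 2 * c) -> h ^+ 2 <= a * c.
Proof.
move=> H; have a0 : 0 <= a by have := H 0; lra.
have [c0|c0|c0] := ltgtP c 0.
- have [a1|a1] := ltrP a (- c); last first.
    have := H (1 + a / (- c)); have := H (- (1 + a / (- c))).
    have c1 : 0 < - c by lra.
    have u0 : 0 <= a / - c by rewrite divr_ge0// ltW.
    have : (a / - c) * (- c) = a by rewrite divfK//; lra.
    set u := a / - c in u0 *; nra.
  have := H (1 + 1); have := H (- (1 + 1)); nra.
- have := H (- (h / c)).
  have e : (h / c) * c = h by rewrite divfK//; lra.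
  have -> : a + 2 * - (h / c) * h + (- (h / c)) ^+ 2 * c = a - h / c * h.
    by set u := h / c in e *; rewrite -e; ring.
  move=> H1; have : 0 <= (a - h / c * h) * c by rewrite mulr_ge0// ltW.
  by rewrite mulrBl mulrAC e subr_ge0.
- rewrite c0 mulr0; have [->|h0] := eqVneq h 0; first by rewrite expr0n.
  have := H (- ((a + 1) / h)); rewrite c0 mulr0 addr0 mulrN mulNr -mulrA divfK//.
  lra.
Qed.

Lemma hform_CS b : hform b -> (forall x, 0 <= b x x) ->
  forall x y, b x y ^+ 2 <= b x x * b y y.
Proof.
move=> fb b0 x y; apply: discriminant_le => t.
have := b0 (x + ofR t *: y).
rewrite (hformDl fb) !(hformDr fb) !(hformZRr fb) !(hformZRl fb) (hformC fb y x).
by congr (0 <= _); ring.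
Qed.

Lemma hform_sqrt_triangle b : hform b -> (forall x, 0 <= b x x) ->
  forall x y, Num.sqrt (b (x + y) (x + y)) <= Num.sqrt (b x x) + Num.sqrt (b y y).
Proof.
move=> fb b0 x y.
rewrite -ler_sqr ?nnegrE ?addr_ge0 ?sqrtr_ge0// sqr_sqrtr// sqrrD !sqr_sqrtr//.
rewrite (hformDl fb) !(hformDr fb) (hformC fb y x) addrA -addrA.
have : b x y <= Num.sqrt (b x x) * Num.sqrt (b y y).
  apply: le_trans (ler_norm _) _.
  by rewrite -sqrtrM// -sqrtr_sqr ler_wsqrtr// hform_CS.
lra.
Qed.

Lemma coercive_hform_ge0 b : coercive_hform b -> forall x, 0 <= b x x.
Proof.
move=> [_ [c [c0 H]]] x; apply: le_trans (H x).
by rewrite mulr_ge0 ?sqr_ge0// ltW.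
Qed.

Lemma coercive_hform_sep b x y : coercive_hform b ->
  (forall z, b x z = b y z) -> x = y.
Proof.
move=> [fb [c [c0 H]]] E; apply/eqP; rewrite -subr_eq0; apply/eqP/nrm_eq0/eqP.
have := H (x - y); rewrite (hformBl fb) E subrr pmulr_rle0// => h.
by rewrite -sqrf_eq0 eq_le h sqr_ge0.
Qed.

Lemma hform_sqrt_bounds b : coercive_hform b ->
  norm_equiv (fun x => Num.sqrt (b x x)).
Proof.
move=> [fb [c [c0 H]]]; have [K [K0 HK]] := hform_bounded fb.
exists (Num.sqrt c), (Num.sqrt K); rewrite !sqrtr_gt0; split=> // x.
have nE : nrm x = Num.sqrt (nrm x ^+ 2) by rewrite sqrtr_sqr ger0_norm// nrm_ge0.
rewrite nE -!sqrtrM ?(ltW c0) ?(ltW K0)// !ler_wsqrtr//.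
by rewrite (le_trans (ler_norm _))// expr2 mulrA.
Qed.

End Forms.

Lemma invS_lt {R : realType} (e : R) : 0 < e ->
  exists N, forall n, (N <= n)%N -> n.+1%:R^-1 < e.
Proof.
move=> e0; have [N _ HN] := near_infty_natSinv_lt (PosNum e0).
by exists N => n; exact: HN.
Qed.

Section Riesz.
Context {R : realType} {k : scalars} {X : completeNormedModType (sfield R k)}.
Implicit Types (b : X -> X -> R) (x y z : X).

(** The representing vector minimises J x = b x x - 2 * l x: a minimising
sequence is Cauchy by the parallelogram identity, and at the minimum the
first-order term b v y - l y vanishes. Real linearity of [l] suffices, which
is why functionals given by real integrals are covered. *)
Theorem riesz b (l : X -> R) (M : R) : coercive_hform b -> 0 <= M ->
  (forall x y, l (x + y) = l x + l y) ->
  (forall r x, l (ofR r *: x) = r * l x) ->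
  (forall x, l x <= M * nrm x) ->
  exists v, forall y, b v y = l y.
Proof.
move=> [fb [c [c0 cb]]] M0 lD lZ lM; have [K [K0 Kb]] := hform_bounded fb.
pose J x := b x x - 2 * l x.
have lN x : l (- x) = - l x by rewrite -mulN1r -lZ ofRN ofR1 scaleN1r.
have lB x y : l (x - y) = l x - l y by rewrite lD lN.
have Jlb x : - (M ^+ 2 / c) <= J x.
  rewrite /J; have := cb x; have := lM x.
  have : 0 <= (c * nrm x - M) ^+ 2 / c by rewrite divr_ge0 ?sqr_ge0// ltW.
  have -> : (c * nrm x - M) ^+ 2 / c = c * nrm x ^+ 2 - 2 * (M * nrm x) + M ^+ 2 / c.
    by field; rewrite gt_eqF.
  lra.
pose E := range J.
have infE : has_inf E.
  split; first by exists (J 0), 0.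
  by exists (- (M ^+ 2 / c)) => _ [x _ <-].
pose m := inf E.
have mJ x : m <= J x by apply: ge_inf; [exact: infE.2|exists x].
have JD x y : J (x + y) = J x + 2 * (b x y - l y) + b y y.
  by rewrite /J (hformDl fb) !(hformDr fb) lD (hformC fb y x); ring.
(* The parallelogram identity compares x and y with their midpoint, where
   J is at least m. *)
have mid x y : c * nrm (x - y) ^+ 2 <= 2 * (J x - m + (J y - m)).
  have := mJ (ofR 2^-1 *: (x + y)); have := cb (x - y).
  rewrite /J lZ lD (hformZRl fb) (hformZRr fb) !(hformBl fb) !(hformBr fb).
  rewrite !(hformDl fb) !(hformDr fb) (hformC fb y x).
  lra.
have ex n : exists x, J x < m + n.+1%:R^-1.
  have n0 : 0 < n.+1%:R^-1 :> R by rewrite invr_gt0.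
  have [_ [x _ <-] h] := inf_adherent n0 infE.
  by exists x.
have [u Hu] := choice ex.
have [v Hv] : exists v, forall e, 0 < e -> exists N, forall n, (N <= n)%N -> nrm (u n - v) < e.
  apply: cauchy_nrm => e e0.
  have e1 : 0 < c * e ^+ 2 / 4 by rewrite divr_gt0// mulr_gt0// exprn_gt0.
  have [N HN] := invS_lt e1.
  exists N => i j Ni Nj.
  rewrite -ltr_sqr ?nnegrE ?nrm_ge0 ?ltW// -(ltr_pM2l c0).
  apply: le_lt_trans (mid _ _) _.
  have hi : J (u i) - m < c * e ^+ 2 / 4 by rewrite ltrBlDl (lt_trans (Hu i))// ltrD2l HN.
  have hj : J (u j) - m < c * e ^+ 2 / 4 by rewrite ltrBlDl (lt_trans (Hu j))// ltrD2l HN.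
  by lra.
have Jv : J v <= m.
  apply/ler_addgt0Pr => e e0.
  pose L := 2 * K * nrm v + 2 * M + 1.
  have L0 : 0 < L.
    rewrite /L; have : 0 <= 2 * K * nrm v by rewrite !mulr_ge0 ?nrm_ge0// ltW.
    lra.
  have e2 : 0 < e / 2 by lra.
  have [N HN] := Hv (e / 2 / L) (divr_gt0 e2 L0).
  have [N' HN'] := invS_lt e2.
  pose n := maxn N N'; pose d := u n - v.
  have := HN n (leq_maxl _ _); rewrite -/d ltr_pdivlMr// => nd.
  have Jd : J (v + d) < m + e / 2.
    by rewrite addrC subrK (lt_trans (Hu n))// ltrD2l HN'// leq_maxr.
  move: Jd; rewrite JD.
  have := Kb v d; rewrite ler_norml => /andP[h1 _].
  have := lM d.
  have : 0 <= b d d by apply: le_trans (cb d); rewrite mulr_ge0 ?sqr_ge0// ltW.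
  by move: nd; rewrite /L; have := nrm_ge0 d; lra.
exists v => y; apply/eqP; rewrite -subr_eq0 -sqrf_eq0 eq_le sqr_ge0 andbT.
(* Minimality along v + t y makes the linear term in t vanish. *)
rewrite -(mul0r (b y y)); apply: discriminant_le => t; rewrite add0r.
have := mJ (v + ofR t *: y); rewrite JD (hformZRl fb) !(hformZRr fb) lZ.
by move: Jv; nra.
Qed.

(** Riesz applied to each b x; linearity and boundedness of the representing
map follow from its uniqueness. *)
Theorem hform_operator b0 b : coercive_hform b0 -> hform b ->
  exists P : {linear X -> X}, bounded_op P /\ forall x y, b0 (P x) y = b x y.
Proof.
move=> cb0 fb; have [fb0 [c [c0 cb]]] := cb0.
have [K [K0 Kb]] := hform_bounded fb.
have ex x : exists v, forall y, b0 v y = b x y.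
  apply: (@riesz _ _ (K * nrm x)) => //.
  - by rewrite mulr_ge0 ?nrm_ge0// ltW.
  - exact: hformDr.
  - by move=> r y; exact: hformZRr.
  - by move=> y; rewrite (le_trans (ler_norm _)).
have [P HP] := choice ex.
have lP : linear P.
  move=> a x y; apply: (coercive_hform_sep cb0) => z.
  by rewrite HP !(hformDl fb) (hformDl fb0) HP (hformZl fb) (hformZl fb0) HP.
have [P' PE] := exists_linear lP.
exists P'; split; last by move=> x y; rewrite PE HP.
apply/bounded_opP; exists (K / c); split; first by rewrite divr_gt0.
move=> x; rewrite PE.
have := cb (P x); have := Kb x (P x); rewrite HP => /ler_normlP[_ h1] h2.
have [->|n0] := eqVneq (nrm (P x)) 0.
  by rewrite mulr_ge0 ?nrm_ge0 ?divr_ge0// ltW.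
have n1 : 0 < nrm (P x) by rewrite lt_def n0 nrm_ge0.
rewrite mulrAC ler_pdivlMr// -(ler_pM2r n1) mulrC mulrA.
by move: (le_trans h2 h1); nra.
Qed.

End Riesz.

(** * Square roots of coercive forms *)

Section SquareRoot.
Context {R : realType} {k : scalars} {X : completeNormedModType (sfield R k)}.
Variable b0 : X -> X -> R.
Hypothesis b0_coercive : coercive_hform b0.
Hypothesis b0_nrm : forall x, b0 x x = nrm x ^+ 2.

Let fb0 : hform b0 := proj1 b0_coercive.

Lemma inner_CS x y : `|b0 x y| <= nrm x * nrm y.
Proof.
rewrite -ler_sqr ?nnegrE ?mulr_ge0 ?nrm_ge0// real_normK ?num_real//.
by rewrite exprMn -!b0_nrm hform_CS// => z; rewrite b0_nrm sqr_ge0.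
Qed.

(** The norm of a positive operator is governed by its quadratic form:
apply Cauchy-Schwarz for [b] to x and Q x. *)
Lemma nrm_le_of_hform b (Q : X -> X) (q : R) : hform b -> 0 <= q ->
  (forall x, 0 <= b x x <= q * nrm x ^+ 2) ->
  (forall x y, b0 (Q x) y = b x y) -> forall x, nrm (Q x) <= q * nrm x.
Proof.
move=> fb q0 bq QE x.
have bp z : 0 <= b z z by have /andP[] := bq z.
have bq' z : b z z <= q * nrm z ^+ 2 by have /andP[] := bq z.
have := hform_CS fb bp x (Q x); rewrite -QE b0_nrm => h.
have := le_trans h (ler_pM (bp x) (bp _) (bq' x) (bq' _)).
have [->|n0] := eqVneq (nrm (Q x)) 0; first by rewrite mulr_ge0// nrm_ge0.
have n1 : 0 < nrm (Q x) ^+ 2 by rewrite exprn_gt0// lt_def n0 nrm_ge0.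
have -> : q * nrm x ^+ 2 * (q * nrm (Q x) ^+ 2) = (q * nrm x) ^+ 2 * nrm (Q x) ^+ 2.
  by ring.
rewrite expr2 ler_pM2r// => h'.
by rewrite -ler_sqr ?nnegrE ?mulr_ge0 ?nrm_ge0.
Qed.

(** The square root of the operator 1 - Q with |Q| <= q < 1 is sought as
1 - Y, so that Y = (Q + Y^2) / 2. On the ball of radius q this fixed-point map
is a contraction with factor q, hence the iteration from 0 converges
geometrically. *)
Section Iteration.
Variables (Q : {linear X -> X}) (q : R).
Hypothesis q01 : 0 <= q < 1.
Hypothesis Q_le : forall x, nrm (Q x) <= q * nrm x.
Hypothesis Q_sym : forall x y, b0 (Q x) y = b0 x (Q y).

Fixpoint root_iter n : {linear X -> X} :=
  if n is n.+1 then ofR 2^-1 \*: (Q \+ (root_iter n \o root_iter n)) else \0.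

Let q0 : 0 <= q. Proof. by case/andP: q01. Qed.
Let q1 : q < 1. Proof. by case/andP: q01. Qed.

Lemma root_iterS n x :
  root_iter n.+1 x = ofR 2^-1 *: (Q x + root_iter n (root_iter n x)).
Proof. by []. Qed.

Lemma root_iter_le n x : nrm (root_iter n x) <= q * nrm x.
Proof.
elim: n x => [x|n IH x]; first by rewrite nrm0 mulr_ge0// nrm_ge0.
rewrite root_iterS nrmZR gtr0_norm ?invr_gt0//.
have h := nrmD (Q x) (root_iter n (root_iter n x)).
have h1 := Q_le x; have h2 := IH (root_iter n x); have h3 := IH x.
have h4 : q * nrm (root_iter n x) <= q * nrm x.
  rewrite ler_wpM2l// (le_trans h3)// ler_piMl ?nrm_ge0// ltW//.
by lra.
Qed.

Lemma root_iter_sym n x y : b0 (root_iter n x) y = b0 x (root_iter n y).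
Proof.
elim: n x y => [x y|n IH x y]; first by rewrite (hformC fb0 x) !(hform0l fb0).
rewrite !root_iterS (hformZRl fb0) (hformZRr fb0) (hformDl fb0) (hformDr fb0).
by rewrite Q_sym !IH.
Qed.

Lemma root_iter_cauchy n x :
  nrm (root_iter n.+1 x - root_iter n x) <= q * nrm x * q ^+ n.
Proof.
elim: n x => [x|n IH x].
  have z y : root_iter 0 y = 0 by [].
  rewrite root_iterS !z addr0 subr0 expr0 mulr1 nrmZR gtr0_norm ?invr_gt0//.
  by have := Q_le x; have := nrm_ge0 (Q x); lra.
rewrite (root_iterS n.+1) (root_iterS n) -scalerBr nrmZR gtr0_norm ?invr_gt0//.
set Y1 := root_iter n.+1; set Y0 := root_iter n.
rewrite opprD addrACA subrr add0r.
have -> : Y1 (Y1 x) - Y0 (Y0 x) = Y1 (Y1 x - Y0 x) + (Y1 (Y0 x) - Y0 (Y0 x)).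
  by rewrite linearB addrA subrK.
have h := nrmD (Y1 (Y1 x - Y0 x)) (Y1 (Y0 x) - Y0 (Y0 x)).
have h1 := root_iter_le n.+1 (Y1 x - Y0 x).
have h2 := IH x; have h3 := IH (Y0 x); rewrite -/Y0 -/Y1 in h1 h2 h3.
have h4 : q * nrm (Y1 x - Y0 x) <= q * (q * nrm x * q ^+ n) by rewrite ler_wpM2l.
have h5 : q * nrm (Y0 x) * q ^+ n <= q * (q * nrm x) * q ^+ n.
  by rewrite ler_wpM2r ?exprn_ge0// ler_wpM2l// root_iter_le.
rewrite exprS.
by lra.
Qed.

Lemma le_geo (u w C : R) : 0 <= C -> (forall n, u <= w + C * q ^+ n) -> u <= w.
Proof.
move=> C0 H; apply/ler_addgt0Pr => e e0; have [N HN] := geo_lt C0 q01 e0.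
by rewrite (le_trans (H N))// lerD2l ltW// HN.
Qed.

Lemma eq0_geo (z : X) (C : R) : 0 <= C -> (forall n, nrm z <= C * q ^+ n) -> z = 0.
Proof.
move=> C0 H; apply: nrm_eq0; apply/eqP; rewrite eq_le nrm_ge0 andbT.
by apply: (le_geo C0) => n; rewrite add0r.
Qed.

Lemma root_iter_lim : exists Y : {linear X -> X},
  [/\ forall x, nrm (Y x) <= q * nrm x,
      forall x y, b0 (Y x) y = b0 x (Y y) &
      forall x, Y x = ofR 2^-1 *: (Q x + Y (Y x))].
Proof.
have ex x : exists l, forall n,
    nrm (root_iter n x - l) <= q * nrm x / (1 - q) * q ^+ n.
  by apply: geometric_lim => // n; exact: root_iter_cauchy.
have [Y0 HY0] := choice ex.
pose C (x : X) := q * nrm x / (1 - q).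
have C0 x : 0 <= C x by rewrite divr_ge0 ?mulr_ge0 ?nrm_ge0// subr_ge0 ltW.
have HY x n : nrm (Y0 x - root_iter n x) <= C x * q ^+ n by rewrite nrmC HY0.
have lY : linear Y0.
  move=> a x y; apply/eqP; rewrite -subr_eq0; apply/eqP.
  apply: (@eq0_geo _ (C (a *: x + y) + re `|a| * C x + C y)) => [|n].
    by rewrite !addr_ge0// mulr_ge0// re_normr_ge0.
  have -> : Y0 (a *: x + y) - (a *: Y0 x + Y0 y) =
      (Y0 (a *: x + y) - root_iter n (a *: x + y))
      + (a *: (root_iter n x - Y0 x) + (root_iter n y - Y0 y)).
    by rewrite linearP scalerBr [X in _ = _ + X]addrACA -opprD subrKA.
  rewrite (le_trans (nrmD _ _))// !mulrDl -addrA lerD//.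
  by rewrite (le_trans (nrmD _ _))// nrmZ -mulrA lerD// ler_wpM2l ?re_normr_ge0.
have [Y YE] := exists_linear lY.
have {}HY x n : nrm (Y x - root_iter n x) <= C x * q ^+ n by rewrite YE HY.
have Yle x : nrm (Y x) <= q * nrm x.
  apply: (le_geo (C0 x)) => n; rewrite -[Y x](subrK (root_iter n x)).
  by rewrite (le_trans (nrmD _ _))// addrC lerD// root_iter_le.
exists Y; split=> // [x y|x].
  apply/eqP; rewrite -subr_eq0 -normr_eq0 eq_le normr_ge0 andbT.
  apply: (@le_geo _ _ (C x * nrm y + nrm x * C y)) => [|n].
    by rewrite addr_ge0// mulr_ge0// nrm_ge0.
  have -> : b0 (Y x) y - b0 x (Y y) =
      b0 (Y x - root_iter n x) y - b0 x (Y y - root_iter n y).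
    by rewrite (hformBl fb0) (hformBr fb0) root_iter_sym; ring.
  rewrite add0r (le_trans (ler_normB _ _))// mulrDl lerD//.
    by rewrite (le_trans (inner_CS _ _))// mulrAC ler_wpM2r ?nrm_ge0.
  by rewrite (le_trans (inner_CS _ _))// -mulrA ler_wpM2l ?nrm_ge0.
apply/eqP; rewrite -subr_eq0; apply/eqP.
apply: (@eq0_geo _ (q * C x + 2^-1 * (q * C x + C (Y x)))) => [|n].
  have h := mulr_ge0 q0 (C0 x).
  by apply: addr_ge0 => //; apply: mulr_ge0; [rewrite invr_ge0|apply: addr_ge0].
have -> : Y x - ofR 2^-1 *: (Q x + Y (Y x)) =
    (Y x - root_iter n.+1 x) + ofR 2^-1 *:
      (root_iter n (root_iter n x - Y x) - (Y (Y x) - root_iter n (Y x))).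
  rewrite root_iterS (linearB (root_iter n)) opprB subrKA.
  set u := root_iter n _; have -> : u - Y (Y x) = Q x + u - (Q x + Y (Y x)).
    by rewrite opprD addrACA subrr add0r.
  by rewrite scalerBr subrKA.
rewrite (le_trans (nrmD _ _))// mulrDl lerD//.
  by rewrite (le_trans (HY _ _))// exprS mulrCA mulrA.
rewrite nrmZR gtr0_norm ?invr_gt0// -mulrA ler_wpM2l ?invr_ge0//.
rewrite (le_trans (nrmB _ _))// mulrDl lerD//.
by rewrite (le_trans (root_iter_le _ _))// -mulrA ler_wpM2l// nrmC.
Qed.

End Iteration.

(** After division by a bound K, the operator of [b] is 1 - Q with
0 <= Q <= q < 1, where q = 1 - c / K. Its square root 1 - Y is symmetric, so
F = sqrt K * (1 - Y) satisfies |F x|^2 = b x x. It is onto because F^2 is the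
operator of [b], which is onto by the Riesz theorem for [b]. *)
Theorem hform_square_root b : coercive_hform b ->
  exists F F' : {linear X -> X}, [/\ bounded_op F, bounded_op F',
    cancel F F', cancel F' F & forall x, nrm (F x) ^+ 2 = b x x].
Proof.
move=> cb; have [fb [c [c0 bc]]] := cb; have [K0 [K00 bK0]] := hform_bounded fb.
(* Adding c ensures c / K <= 1. *)
pose K := K0 + c.
have K1 : 0 < K by rewrite addr_gt0.
have bK x : b x x <= K * nrm x ^+ 2.
  rewrite (le_trans (ler_norm _))// (le_trans (bK0 _ _))// -mulrA -expr2.
  by rewrite ler_wpM2r ?sqr_ge0// lerDl ltW.
pose q := 1 - c / K.
have cK : 0 < c / K by rewrite divr_gt0.
have cK' : c / K <= 1 by rewrite ler_pdivrMr// mul1r lerDr ltW.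
have q01 : 0 <= q < 1 by rewrite /q; apply/andP; split; lra.
pose bq x y := b0 x y + (- K^-1) * b x y.
have fbq : hform bq by apply: hformD => //; exact: hformZ.
have [Q [_ QE]] := hform_operator b0_coercive fbq.
have bq_bounds x : 0 <= bq x x <= q * nrm x ^+ 2.
  rewrite /bq b0_nrm mulNr; apply/andP; split.
    by rewrite subr_ge0 mulrC ler_pdivrMr// mulrC.
  by rewrite /q mulrBl mul1r lerD2l lerN2 mulrAC mulrC ler_wpM2l// invr_ge0 ltW.
have Qle := nrm_le_of_hform fbq (proj1 (andP q01)) bq_bounds QE.
have Qsym x y : b0 (Q x) y = b0 x (Q y) by rewrite QE (hformC fb0) QE (hformC fbq).
have [Y [Yle Ysym YE]] := root_iter_lim q01 Qle Qsym.
have sqE x : x - Y x - Y (x - Y x) = x - Q x.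
  have : Y x + Y x = Q x + Y (Y x).
    rewrite [in LHS]YE -scalerDl -ofRD.
    by rewrite (_ : 2^-1 + 2^-1 = 1 :> R) ?ofR1 ?scale1r//; lra.
  move=> h; rewrite linearB opprB addrCA -addrA -opprD h opprD.
  by rewrite (addrC (- Q x)) [Y (Y x) + _]addrCA addNKr.
pose S0 x := ofR (Num.sqrt K) *: (x - Y x).
have lS0 : linear S0.
  move=> a x y; rewrite /S0 (linearP Y) scalerA [a * _]mulrC -scalerA -scalerDr.
  by congr (_ *: _); rewrite scalerBr opprD addrACA.
have [F FE] := exists_linear lS0.
have KK : Num.sqrt K * Num.sqrt K = K by rewrite -expr2 sqr_sqrtr// ltW.
have Fb x : nrm (F x) ^+ 2 = b x x.
  rewrite -b0_nrm FE (hformZRl fb0) (hformZRr fb0) mulrA KK.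
  have -> : b0 (x - Y x) (x - Y x) = b0 (x - Q x) x.
    by rewrite -sqE (hformBl fb0 (x - Y x)) Ysym (hformBr fb0).
  by rewrite (hformBl fb0) QE /bq opprD addrA subrr add0r mulNr opprK mulrA divff ?mul1r// gt_eqF.
have Fbnd : bounded_op F.
  apply/bounded_opP; exists (Num.sqrt K); rewrite sqrtr_gt0; split=> // x.
  rewrite -ler_sqr ?nnegrE ?mulr_ge0 ?sqrtr_ge0 ?nrm_ge0//.
  by rewrite Fb exprMn sqr_sqrtr// ltW.
have Finj : injective F.
  move=> x y E; apply/eqP; rewrite -subr_eq0; apply/eqP/nrm_eq0/eqP.
  have := bc (x - y); rewrite -Fb linearB E subrr nrm0 expr0n /= pmulr_rle0// => h.
  by rewrite -sqrf_eq0 eq_le h sqr_ge0.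
have FF x : b0 (F (F x)) =1 b x.
  move=> y; rewrite !FE /S0 linearZ /= -scalerBr scalerA -ofRM KK (hformZRl fb0) sqE.
  by rewrite (hformBl fb0) QE /bq opprD addrA subrr add0r mulNr opprK mulrA divff ?mul1r// gt_eqF.
have surj y : exists x, F x = y.
  have [v Hv] : exists v, forall z, b v z = b0 y z.
    apply: (@riesz _ _ _ _ _ (nrm y)) => //.
    - exact: nrm_ge0.
    - exact: hformDr.
    - by move=> r x; exact: hformZRr.
    - by move=> x; rewrite (le_trans (ler_norm _))// inner_CS.
  exists (F v); apply: (coercive_hform_sep b0_coercive) => z.
  by rewrite FF Hv.
have [F0 F0E] := choice surj.
have lF0 : linear F0 by move=> a x y; apply: Finj; rewrite linearP !F0E.
have [F' F'E] := exists_linear lF0.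
have FK' : cancel F' F by move=> y; rewrite F'E F0E.
exists F, F'; split=> //; last by move=> x; apply: Finj; rewrite FK'.
apply/bounded_opP; exists (Num.sqrt c^-1); rewrite sqrtr_gt0 invr_gt0; split=> // x.
rewrite -ler_sqr ?nnegrE ?mulr_ge0 ?sqrtr_ge0 ?nrm_ge0//.
rewrite exprMn sqr_sqrtr ?invr_ge0 ?(ltW c0)// -(ler_pM2l c0) mulVKf ?gt_eqF//.
by rewrite (le_trans (bc _))// -Fb FK'.
Qed.

End SquareRoot.

(** * Bounds on Bochner integrals, Dini derivatives and inputs *)

(** The integral of a nonnegative function is the supremum over the simple
functions below it, hence monotone without measurability. *)
Lemma le_integral_nonmeasurable d (Om : measurableType d) (R : realType)
    (mu : {measure set Om -> \bar R}) (D : set Om) (f g : Om -> \bar R) :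
  (forall w, D w -> (0 <= f w)%E) -> (forall w, D w -> (f w <= g w)%E) ->
  (\int[mu]_(w in D) f w <= \int[mu]_(w in D) g w)%E.
Proof.
move=> f0 fg; have g0 w : D w -> (0 <= g w)%E by move=> Dw; rewrite (le_trans (f0 w Dw))// fg.
rewrite !ge0_integralE//; apply: ereal_sup_le => _ /= [h hf <-]; exists h => // w.
by apply: le_trans (hf w) _; exact: lee_restrict.
Qed.

Section BochnerBound.
Context {R : realType} {k : scalars} {d : measure_display}
  {Om : measurableType d} (mu : {measure set Om -> \bar R})
  {V : normedModType (sfield R k)}.

Lemma nrm_sum (I : eqType) (l : seq I) (F : I -> V) :
  nrm (\sum_(i <- l) F i) <= \sum_(i <- l) nrm (F i).
Proof.
elim/big_rec2: _ => [|i a b _ IH]; first by rewrite nrm0.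
by rewrite (le_trans (nrmD _ _))// lerD2l.
Qed.

(** The distance |f - s| need not be measurable, so the triangle inequality
cannot be integrated. Instead (|s| - C)^+ is simple, lies below |f - s| outside
a null set, and its integral is at least that of |s| minus C * mu D. *)
Lemma simple_integral_le (D : set Om) (f s : Om -> V) (C : R) :
  measurable D -> (mu D < +oo)%E -> 0 <= C -> integrable_simple_on mu D s ->
  {ae mu, forall w, D w -> nrm (f w) <= C} ->
  ((nrm (simple_integral mu D s) - C * fine (mu D))%:E
    <= \int[mu]_(w in D) (nrm (f w - s w))%:E)%E.
Proof.
move=> mD Dfin C0 [[sfin sm] _] [N [mN N0 Nsub]].
pose A y := D `&` s @^-1` [set y].
have mA y : measurable (A y) by exact: sm.
have mA' y : measurable (A y `\` N) by exact: measurableD.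
have muA' y : mu (A y `\` N) = mu (A y).
  rewrite (measureDI mu (mA y) mN) [X in (_ + X)%E](_ : _ = 0%E) ?adde0//.
  apply/eqP; rewrite -measure_le0 -N0 le_measure ?inE//; first exact: measurableI.
have Afin y : mu (A y) \is a fin_num.
  rewrite ge0_fin_numE//; apply: le_lt_trans Dfin.
  by rewrite le_measure ?inE// => w [].
(* The simple function (|s| - C)^+, cut off on the null set N. *)
pose c (y : V) : R := Num.max (nrm y - C) 0.
have c0 y : 0 <= c y by rewrite /c le_max lexx orbT.
pose g w := (\sum_(y \in s @` D) (c y * \1_(A y `\` N) w)%:E)%E.
have gE : (\int[mu]_(w in D) g w = \sum_(y \in s @` D) (c y * fine (mu (A y)))%:E)%E.
  rewrite ge0_integral_fsum//; last 2 first.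
  - move=> y; apply/measurable_EFinP; apply: measurable_funM => //.
  - by move=> y w _; rewrite lee_fin mulr_ge0.
  apply: eq_fsbigr => y _; rewrite EFinM fineK// -muA'.
  under eq_integral do rewrite EFinM.
  rewrite ge0_integralZl_EFin//; last first.
  - by apply/measurable_EFinP.
  rewrite integral_indic// setIidl// => w [[]//].
have g_le : (\int[mu]_(w in D) g w <= \int[mu]_(w in D) (nrm (f w - s w))%:E)%E.
  apply: le_integral_nonmeasurable => w Dw.
    by apply: fsume_ge0 => y _; rewrite lee_fin mulr_ge0.
  rewrite /g (fsbigD1 (s w))//=; last by exists w.
  rewrite fsbig1 ?adde0; last first.
    move=> y [_ /= ys]; rewrite indicE memNset ?mulr0// => -[[_ /= E] _].
    by apply: ys.
  rewrite lee_fin indicE; have [/set_mem[_ nN]|_] := boolP (_ \in _); last by rewrite mulr0 nrm_ge0.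
  have fC : nrm (f w) <= C by apply: contrapT => h; apply: nN; apply: Nsub => /(_ Dw).
  rewrite mulr1 /c ge_max nrm_ge0 andbT lerBlDr.
  rewrite -{1}(subKr (f w) (s w)) (le_trans (nrmB _ _))// addrC lerD2l//.
apply: le_trans g_le; rewrite gE.
rewrite fsbig_finite//= sumEFin lee_fin lerBlDr.
rewrite /simple_integral fsbig_finite//= (le_trans (nrm_sum _ _))//.
have muD : \sum_(y <- finmap.enum_fset (fset_set (s @` D))) fine (mu (A y)) <= fine (mu D).
  rewrite -lee_fin fineK; last by rewrite ge0_fin_numE.
  rewrite -sumEFin; under eq_bigr do rewrite fineK//.
  have := @measure_fin_bigcup _ _ _ mu V (s @` D) A sfin; rewrite fsbig_finite//= => <-//.
  - rewrite le_measure ?inE//; last by move=> w [y _ []].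
    exact: fin_bigcup_measurable.
  - by move=> y1 y2 _ _ [w [[_ <-] [_ <-]]].
apply: (@le_trans _ _ (\sum_(y <- finmap.enum_fset (fset_set (s @` D))) c y * fine (mu (A y))
   + C * \sum_(y <- finmap.enum_fset (fset_set (s @` D))) fine (mu (A y)))); last first.
  by rewrite lerD2l ler_wpM2l.
rewrite mulr_sumr -big_split /=; apply: ler_sum => y _.
rewrite nrmZR ger0_norm ?fine_ge0// mulrC -mulrDl ler_wpM2r ?fine_ge0//.
by rewrite -lerBlDr /c le_max lexx.
Qed.

(** Valid for arbitrary [f], since a nonintegrable [f] has integral 0. *)
Lemma nrm_bochner_le (D : set Om) (f : Om -> V) (C : R) :
  measurable D -> (mu D < +oo)%E -> 0 <= C ->
  {ae mu, forall w, D w -> nrm (f w) <= C} ->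
  nrm (bochner_integral mu D f) <= C * fine (mu D).
Proof.
move=> mD Dfin C0 fC; rewrite /bochner_integral; case: xgetP => [v _|_]; last first.
  by rewrite nrm0 mulr_ge0// fine_ge0.
move=> [_ [s [sint s0 sv]]].
apply/ler_addgt0Pr => e e0.
have e2 : 0 < e / 2 by lra.
have N1 : \forall n \near \oo, (\int[mu]_(w in D) (nrm (f w - s n w))%:E < (e / 2)%:E)%E.
  apply: (s0 [set y | (y < (e / 2)%:E)%E]); apply: open_ereal_lt'; by rewrite lte_fin.
have /cvg_nrmP /(_ _ e2) N2 := sv.
have [n [n1 n2]] := filter_ex (filterI N1 N2).
have h1 := simple_integral_le mD Dfin C0 (sint n) fC.
have h2 : nrm (simple_integral mu D (s n)) - C * fine (mu D) < e / 2.
  by rewrite -lte_fin; exact: le_lt_trans h1 n1.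
have := nrmB (simple_integral mu D (s n)) (simple_integral mu D (s n) - v).
rewrite subKr; lra.
Qed.

End BochnerBound.

Section Dini.
Context {R : realType}.

Lemma limf_esup_le {T : choiceType} {Y : filteredType T} (f : Y -> \bar R) (F : set_system Y) (r : R) :
  Filter F ->
  (limf_esup f F <= r%:E)%E <->
  forall e : R, 0 < e -> \forall h \near F, (f h <= (r + e)%:E)%E.
Proof.
move=> FF; split=> [H e e0|H].
  have : (limf_esup f F < (r + e)%:E)%E.
    by apply: le_lt_trans H _; rewrite lte_fin ltrDl.
  move=> /ereal_inf_lt [_ [V FV <-] h]; apply: filterS FV => x Vx.
  apply/ltW/(le_lt_trans _ h); apply: ereal_sup_ubound; by exists x.
apply/lee_addgt0Pr => e /H h.
apply: (@le_trans _ _ (ereal_sup (f @` [set x | (f x <= (r + e)%:E)%E]))).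
  by apply: ereal_inf_lbound; eexists; first exact: h.
by apply: ge_ereal_sup => _ [x ? <-].
Qed.

(** The form in which Dini derivatives are used throughout: an upper bound L
means growth of at most (L + e) h over all short times h. *)
Lemma dini_le (g : R -> R) (g0 L : R) :
  (dini g g0 <= L%:E)%E <->
  forall e : R, 0 < e -> \forall h \near 0^'+, g h - g0 <= h * (L + e).
Proof.
rewrite /dini limf_esup_le; split=> H e e0; near=> h.
  have h0 : 0 < h by near: h; exact: nbhs_right_gt.
  rewrite -ler_pdivrMl// -lee_fin; near: h; exact: H.
have h0 : 0 < h by near: h; exact: nbhs_right_gt.
rewrite lee_fin ler_pdivrMl//; near: h; exact: H.
Unshelve. all: by end_near. Qed.

End Dini.

Section Inputs.
Context {R : realType} {k : scalars} {U : normedModType (sfield R k)}.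
Local Notation mu := (@lebesgue_measure R).

Lemma Linfty_normE (u : R -> U) (t : R) : Linfty_norm u t =
  ess_sup mu (abse \o ((fun s : R => (nrm (u s))%:E) \_ `]0, t[)).
Proof.
rewrite /Linfty_norm unlock; case: ifPn => // /negP[].
apply: (@lt_le_trans _ _ (mu `[0%R, 1%R])); last by rewrite le_measure ?inE.
by rewrite lebesgue_measure_itv /= lte_fin ltr01 sube0.
Qed.

Lemma le_Linfty_norm (u : R -> U) (s t : R) : s <= t ->
  (Linfty_norm u s <= Linfty_norm u t)%E.
Proof.
move=> st; rewrite !Linfty_normE; apply: le_ess_sup; apply/nearW => w /=.
rewrite !patchE; case: ifPn => [/set_mem|_]; last by rewrite abse0 abse_ge0.
rewrite /= in_itv/= => /andP[w0 ws].
have wt : `]0, t[%classic w by rewrite /= in_itv/= w0 (lt_le_trans ws).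
by rewrite (mem_set wt).
Qed.

Lemma Linfty_norm0_ge0 (u : R -> U) : 0 <= Linfty_norm0 u.
Proof.
by apply/fine_ge0/limf_esup_ge0 => [|t]; [exact: filter_not_empty|exact: Lnorm_ge0].
Qed.

(** Monotonicity of the essential supremum in t makes the limit superior
finite, so that it bounds the input on short intervals up to e. *)
Lemma Linfty_near (u : R -> U) : Linfty_loc u -> forall e, 0 < e ->
  \forall t \near 0^'+, {ae mu, forall s, `]0, t[%classic s -> nrm (u s) <= Linfty_norm0 u + e}.
Proof.
move=> [_ ufin] e e0.
have fin : limf_esup (Linfty_norm u) 0^'+ \is a fin_num.
  rewrite ge0_fin_numE; last first.
    by apply: limf_esup_ge0 => [|t]; [exact: filter_not_empty|exact: Lnorm_ge0].
  apply: le_lt_trans (ufin 1 ltr01).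
  have := fineK (_ : Linfty_norm u 1 \is a fin_num).
  rewrite ge0_fin_numE ?Lnorm_ge0// => /(_ (ufin 1 ltr01)) E.
  rewrite -E; apply/limf_esup_le => d d0.
  near=> t; rewrite EFinD E (le_trans (@le_Linfty_norm u t 1 _))//.
    by near: t; exact: nbhs_right_le.
  by rewrite leeDl// lee_fin ltW.
have H : (limf_esup (Linfty_norm u) 0^'+ <= (Linfty_norm0 u)%:E)%E by rewrite fineK.
move/limf_esup_le : H => /(_ _ e0); apply: filterS => t.
rewrite Linfty_normE => /ess_supP; apply: filterS => s H st; move: H.
by rewrite /= patchE mem_set// gee0_abs ?lee_fin ?nrm_ge0.
Unshelve. all: by end_near. Qed.

Lemma Linfty_loc0 : Linfty_loc (fun _ : R => 0 : U).
Proof.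
split.
  exists (fun _ _ => 0); split => [n|]; last first.
    by apply/nearW => w _; exact: cvg_cst.
  split; first by apply: (@sub_finite_set _ _ [set 0]) => // _ [w _ <-].
  move=> y; have [->|y0] := eqVneq y 0.
    by rewrite (_ : _ @^-1` _ = setT) ?setIT//; apply/seteqP; split.
  rewrite (_ : _ @^-1` _ = set0) ?setI0//; apply/seteqP; split => // w /= E.
  by rewrite E eqxx in y0.
move=> t t0; rewrite Linfty_normE; apply: (@le_lt_trans _ _ 0%E) => //.
apply/ess_supP/nearW => w /=; rewrite patchE; case: ifPn; rewrite ?nrm0 abse0//.
Qed.

End Inputs.

Lemma Linfty_norm0_cst0 {R : realType} {k : scalars} (U : normedModType (sfield R k)) :
  Linfty_norm0 (fun _ : R => 0 : U) = 0.
Proof.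
have H : (limf_esup (Linfty_norm (fun _ : R => 0%R : U)) 0%R^'+ <= 0%:E)%E.
  apply/limf_esup_le => e e0; near=> t.
  rewrite add0r Linfty_normE; apply: (@le_trans _ _ 0%E); last by rewrite lee_fin ltW.
  by apply/ess_supP/nearW => w /=; rewrite patchE; case: ifPn; rewrite ?nrm0 abse0.
have H' : (0 <= limf_esup (Linfty_norm (fun _ : R => 0%R : U)) 0%R^'+)%E.
  by apply: limf_esup_ge0 => [|t]; [exact: filter_not_empty|exact: Lnorm_ge0].
by rewrite /Linfty_norm0 (_ : limf_esup _ _ = 0%E)//; apply/eqP; rewrite eq_le H H'.
Unshelve. all: by end_near. Qed.

(** * Integrals of forms along orbits *)

Section Area.
Context {R : realType}.
Implicit Types (f g G : R -> R) (a b c t : R).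

(** The lower end -1 makes the primitive differentiable on both sides of 0. *)
Definition primitive g t : R := \int[lebesgue_measure]_(s in `[-1, t]) g s.

(** The integral of [g] over [a, b], as an increment of a primitive: its
rules then all follow from the mean value theorem, the shift rule included. *)
Definition area g a b := primitive g b - primitive g a.

Lemma is_derive_primitive g t : continuous g -> -1 < t ->
  is_derive t 1 (primitive g) (g t).
Proof.
move=> cg t1.
have gi : lebesgue_measure.-integrable `[-1, t + 1] (EFin \o g).
  apply: continuous_compact_integrable; first exact: segment_compact.
  exact: continuous_subspaceT.
have tt : t < t + 1 by rewrite ltrDl.
have [dg gE] := continuous_FTC1_closed tt gi t1 (cg t).
by apply: DeriveDef => //; rewrite -gE derive1E.
Qed.

Lemma mean_value G g a b : 0 <= a -> a <= b ->
  (forall t, -1 < t -> is_derive t 1 G (g t)) ->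
  exists2 c, a <= c <= b & G b - G a = g c * (b - a).
Proof.
move=> a0; rewrite le_eqVlt => /predU1P[<- _|ab GE].
  by exists a; rewrite ?lexx// !subrr mulr0.
have GD t : t \in `]a, b[ -> is_derive t 1 G (g t).
  by rewrite in_itv/= => /andP[h _]; apply: GE; lra.
have GC : {within `[a, b], continuous G}.
  apply: derivable_within_continuous => t; rewrite in_itv/= => /andP[h _].
  by have t1 : -1 < t by [lra]; have [] := GE _ t1.
have [c] := MVT ab GD GC.
by rewrite in_itv/= => /andP[/ltW ac /ltW cb] E; exists c; rewrite ?ac.
Qed.

Lemma area_mean g a b : continuous g -> 0 <= a -> a <= b ->
  exists2 c, a <= c <= b & area g a b = g c * (b - a).
Proof. by move=> cg a0 ab; apply: mean_value => // t; exact: is_derive_primitive. Qed.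

Lemma area_lin f g (r s : R) a b : continuous f -> continuous g -> 0 <= a -> a <= b ->
  area (fun t => r * f t + s * g t) a b = r * area f a b + s * area g a b.
Proof.
move=> cf cg a0 ab; pose h t := r * f t + s * g t.
have ch : continuous h.
  by move=> t; apply: cvgD; apply: cvgM; [exact: cvg_cst|exact: cf|exact: cvg_cst|exact: cg].
pose H := primitive h - (r \*: primitive f + s \*: primitive g).
have HE t : -1 < t -> is_derive t 1 H (h t - (r *: f t + s *: g t)).
  move=> t1; apply: is_deriveB; first exact: is_derive_primitive.
  by apply: is_deriveD; apply: is_deriveZ; exact: is_derive_primitive.
have [c _] := mean_value a0 ab HE.
rewrite subrr mul0r => /eqP; rewrite subr_eq0 => /eqP.
move=> E; rewrite /area -/h.
have {}E : primitive h b - (r * primitive f b + s * primitive g b) =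
  primitive h a - (r * primitive f a + s * primitive g a) := E.
by lra.
Qed.

Lemma area_shift g a b h : continuous g -> 0 <= a -> a <= b -> 0 <= h ->
  area (fun t => g (t + h)) a b = area g (a + h) (b + h).
Proof.
move=> cg a0 ab h0; pose g' t := g (t + h).
have cg' : continuous g'.
  move=> t; apply: (@continuous_comp _ _ _ (fun u => u + h) g); last exact: cg.
  by apply: cvgD; [exact: cvg_id|exact: cvg_cst].
pose H := primitive g' - (primitive g \o shift h).
have HE t : -1 < t -> is_derive t 1 H (g' t - g (t + h) * 1).
  move=> t1; apply: is_deriveB; first exact: is_derive_primitive.
  apply: is_derive1_comp; last exact: is_derive_shift.
  by apply: is_derive_primitive => //=; lra.
have [c _] := mean_value a0 ab HE.
rewrite mulr1 subrr mul0r => /eqP; rewrite subr_eq0 => /eqP.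
rewrite /area /H /= !fctE /=; lra.
Qed.

Lemma eq_area f g a b : continuous f -> continuous g -> 0 <= a -> a <= b ->
  (forall t, 0 <= t -> f t = g t) -> area f a b = area g a b.
Proof.
move=> cf cg a0 ab fg.
have cd : continuous (fun t => 1 * f t + (-1) * g t).
  by move=> t; apply: cvgD; apply: cvgM; [exact: cvg_cst|exact: cf|exact: cvg_cst|exact: cg].
have [c /andP[ac _]] := area_mean cd a0 ab.
rewrite area_lin// fg ?(le_trans a0)//; lra.
Qed.

Lemma area_cat g a b c : area g a c = area g a b + area g b c.
Proof. by rewrite /area; ring. Qed.

Lemma area_ge0 g a b : continuous g -> 0 <= a -> a <= b ->
  (forall t, a <= t <= b -> 0 <= g t) -> 0 <= area g a b.
Proof.
move=> cg a0 ab g0; have [c cab ->] := area_mean cg a0 ab.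
by rewrite mulr_ge0 ?subr_ge0// g0.
Qed.

Lemma area_norm_le g a b C : continuous g -> 0 <= a -> a <= b ->
  (forall t, a <= t <= b -> `|g t| <= C) -> `|area g a b| <= C * (b - a).
Proof.
move=> cg a0 ab gC; have [c cab ->] := area_mean cg a0 ab.
by rewrite normrM (@ger0_norm _ (b - a)) ?subr_ge0// ler_wpM2r ?subr_ge0// gC.
Qed.

End Area.

Lemma area_right {R : realType} (g : R -> R) (a e : R) : continuous g -> 0 <= a -> 0 < e ->
  \forall h \near 0^'+, `|area g a (a + h) - h * g a| <= h * e.
Proof.
move=> cg a0 e0.
have /cvgrPdist_le /(_ e e0) [d /= d0 H] := cg a.
near=> h; have h0 : 0 < h by near: h; exact: nbhs_right_gt.
have hd : h < d by near: h; exact: nbhs_right_lt.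
have ah : a <= a + h by rewrite lerDl ltW.
have [c /andP[ac ch] ->] := area_mean cg a0 ah.
have -> : g c * (a + h - a) - h * g a = h * (g c - g a) by ring.
rewrite normrM gtr0_norm// ler_pM2l// distrC; apply: H => /=.
by rewrite distrC ger0_norm ?subr_ge0//; lra.
Unshelve. all: by end_near. Qed.

Section FormContinuity.
Context {R : realType} {k : scalars} {X : normedModType (sfield R k)}.

Lemma hform_cvg (b : X -> X -> R) {S : Type} (F : set_system S) {FF : Filter F}
    (f g : S -> X) u v :
  hform b -> f @ F --> u -> g @ F --> v -> b (f t) (g t) @[t --> F] --> b u v.
Proof.
move=> fb /cvg_nrmP fu /cvg_nrmP gv; have [K [K0 Kb]] := hform_bounded fb.
apply/cvgrPdist_le => e e0; pose L := K * (1 + nrm u + nrm v).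
have L0 : 0 < L by rewrite mulr_gt0// -addrA ltr_pwDl// addr_ge0// nrm_ge0.
pose d := Num.min 1 (e / L).
have d0 : 0 < d by rewrite lt_min ltr01 divr_gt0.
have d1 : d <= 1 by rewrite ge_min lexx.
have dL : d * L <= e by rewrite -ler_pdivlMr// ge_min lexx orbT.
near=> t.
have h1 : nrm (f t - u) < d by near: t; exact: fu.
have h2 : nrm (g t - v) < d by near: t; exact: gv.
have -> : b u v - b (f t) (g t) =
    - (b (f t - u) (g t - v) + b u (g t - v) + b (f t - u) v).
  by rewrite !(hformBl fb) !(hformBr fb); ring.
apply: le_trans dL; rewrite normrN.
rewrite (le_trans (ler_normD _ _))// (le_trans (lerD (ler_normD _ _) (lexx _)))//.
have b1 := Kb (f t - u) (g t - v); have b2 := Kb u (g t - v); have b3 := Kb (f t - u) v.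
have c1 : K * nrm (f t - u) * nrm (g t - v) <= K * d * 1.
  by rewrite ler_pM ?mulr_ge0 ?nrm_ge0 ?(ltW K0)// ?ler_pM2l ?ltW// (lt_le_trans h2).
have c2 : K * nrm u * nrm (g t - v) <= K * nrm u * d.
  by rewrite ler_wpM2l ?mulr_ge0 ?nrm_ge0 ?ltW.
have c3 : K * nrm (f t - u) * nrm v <= K * d * nrm v.
  by rewrite ler_wpM2r ?nrm_ge0// ler_pM2l// ltW.
rewrite /L; lra.
Unshelve. all: by end_near. Qed.

End FormContinuity.

Section Semigroup.
Context {R : realType} {k : scalars} {X : completeNormedModType (sfield R k)}.
Variable T : R -> {linear X -> X}.
Hypothesis semigroup : C0_semigroup T.
Variable M : R.
Hypothesis T_le : forall (t : R) x, 0 <= t -> nrm (T t x) <= M * nrm x.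

Let T0 x : T 0 x = x. Proof. by case: semigroup. Qed.
Let TD t s x : 0 <= t -> 0 <= s -> T (t + s) x = T t (T s x).
Proof. by move=> t0 s0; case: semigroup => _ _ + _; exact. Qed.

(** Right continuity at 0 becomes uniform in time because the operators
T s are uniformly bounded. *)
Lemma orbit_modulus x (e : R) : 0 < e -> exists2 d : R, 0 < d &
  forall s t : R, 0 <= s -> 0 <= t -> `|s - t| < d -> nrm (T s x - T t x) < e.
Proof.
move=> e0; have [_ _ _ /(_ x)/cvg_nrmP] := semigroup.
pose M' := `|M| + 1; have M'0 : 0 < M' by rewrite ltr_wpDl.
move=> /(_ (e / M') (divr_gt0 e0 M'0)) [d /= d0 H]; exists d => // s t s0 t0.
wlog st : s t s0 t0 / s <= t.
  move=> W; case/orP: (le_total s t) => ?; first exact: W.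
  by rewrite nrmC distrC; exact: W.
have [->|sNt] := eqVneq s t; first by rewrite !subrr nrm0.
have ts : 0 < t - s by rewrite subr_gt0 lt_def eq_sym sNt.
rewrite distrC gtr0_norm// nrmC => std.
have -> : T t x - T s x = T s (T (t - s) x - x).
  by rewrite linearB -TD ?(ltW ts)// [s + _]addrC subrK.
rewrite (le_lt_trans (T_le _ s0))//.
have : nrm (T (t - s) x - x) < e / M'.
  by apply: H => //=; rewrite sub0r normrN gtr0_norm.
rewrite ltr_pdivlMr// mulrC; apply: le_lt_trans.
by rewrite ler_wpM2r ?nrm_ge0// (le_trans (ler_norm _))// lerDl.
Qed.

(** Extension of the orbit to negative times by its initial value, which makes
it continuous on the whole line. *)
Definition orbit x t := T (Num.max 0 t) x.

Lemma orbitE x t : 0 <= t -> orbit x t = T t x.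
Proof. by move=> t0; rewrite /orbit max_r. Qed.

Lemma continuous_orbit x (t : R) : orbit x s @[s --> t] --> orbit x t.
Proof.
apply/cvg_nrmP => e e0; have [d d0 H] := orbit_modulus x e0.
have : nbhs t (ball t d) by exact: nbhsx_ballx.
apply: filterS => s; rewrite -ball_normE /= distrC => sd; apply: H; rewrite ?le_max ?lexx//.
apply: le_lt_trans sd; rewrite /Num.max.
by case: ltP => h1; case: ltP => h2; rewrite ?subr0 ?sub0r ?subrr ?normrN ?normr0//;
  rewrite ?ler_normr ?ger0_norm ?ltr0_norm; lra.
Qed.

Lemma continuous_hform_orbit (b : X -> X -> R) x y : hform b ->
  continuous (fun t => b (orbit x t) (orbit y t)).
Proof. by move=> fb t; apply: hform_cvg => //; exact: continuous_orbit. Qed.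

Lemma continuous_hform_orbitl (b : X -> X -> R) x y : hform b ->
  continuous (fun t => b (orbit x t) y).
Proof.
by move=> fb t; apply: hform_cvg => //; [exact: continuous_orbit|exact: cvg_cst].
Qed.

Lemma hform_area (b : X -> X -> R) (t : R) : hform b -> 0 <= t ->
  hform (fun x y => area (fun s => b (orbit x s) (orbit y s)) 0 t).
Proof.
move=> fb t0; have C x y := @continuous_hform_orbit b x y fb.
split=> [x y|x y z|a x y|r x y|].
- by congr area; apply/funext => s; rewrite (hformC fb).
- rewrite -[area _ _ _ in X in _ = X + _]mul1r -[area _ _ _ in X in _ = _ + X]mul1r.
  rewrite -area_lin//; congr area; apply/funext => s.
  by rewrite /orbit linearD (hformDl fb) !mul1r.
- by congr area; apply/funext => s; rewrite /orbit !linearZ /= (hformZl fb).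
- have := area_lin r 0 (C x y) (C x y) (lexx 0) t0; rewrite mul0r addr0 => <-.
  by congr area; apply/funext => s; rewrite /orbit linearZ /= (hformZRl fb) mul0r addr0.
have [K [K0 Kb]] := hform_bounded fb.
exists (K * M ^+ 2 * t + 1); split.
  by rewrite ltr_wpDl// mulr_ge0// mulr_ge0 ?sqr_ge0// ltW.
move=> x y; apply: (@le_trans _ _ (K * (M * nrm x) * (M * nrm y) * (t - 0))).
  apply: area_norm_le => // s /andP[s0 _]; rewrite !orbitE//.
  rewrite (le_trans (Kb _ _))// ler_pM ?mulr_ge0 ?nrm_ge0 ?(ltW K0)// ?T_le//.
  by rewrite ler_wpM2l ?(ltW K0)// T_le.
rewrite -subr_ge0; have := mulr_ge0 (nrm_ge0 x) (nrm_ge0 y).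
by congr (0 <= _); ring.
Qed.

Lemma area_orbit_shift (b : X -> X -> R) x y (h t : R) : hform b -> 0 <= h -> 0 <= t ->
  area (fun s => b (orbit (T h x) s) (orbit (T h y) s)) 0 t =
  area (fun s => b (orbit x s) (orbit y s)) h (t + h).
Proof.
move=> fb h0 t0; have C := @continuous_hform_orbit b x y fb.
rewrite -[X in area _ X (t + h)]add0r -area_shift//; apply: eq_area => //.
- exact: continuous_hform_orbit.
- move=> s; apply: (@continuous_comp _ _ _ (fun u => u + h)
    (fun s => b (orbit x s) (orbit y s))); last exact: C.
  by apply: cvgD; [exact: cvg_id|exact: cvg_cst].
- by move=> s s0; rewrite !orbitE ?addr_ge0// !TD.
Qed.

End Semigroup.

(** * The domain of the generator and dissipativity *)

Section Generator.
Context {R : realType} {k : scalars} {X : completeNormedModType (sfield R k)}.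
Variable T : R -> {linear X -> X}.
Hypothesis semigroup : C0_semigroup T.
Variable M : R.
Hypothesis T_le : forall (t : R) x, 0 <= t -> nrm (T t x) <= M * nrm x.
Variables (DA : set X) (A : X -> X).
Hypothesis Agen : generates DA A T.

Let TD t s x : 0 <= t -> 0 <= s -> T (t + s) x = T t (T s x).
Proof. by move=> t0 s0; case: semigroup => _ _ + _; exact. Qed.

Lemma difference_quotientP x y :
  ofR h^-1 *: (T h x - x) @[h --> 0^'+] --> y <->
  forall e : R, 0 < e -> \forall h \near 0^'+, nrm (T h x - x - ofR h *: y) <= e * h.
Proof.
have E (h : R) : 0 < h ->
    T h x - x - ofR h *: y = ofR h *: (ofR h^-1 *: (T h x - x) - y).
  by move=> h0; rewrite scalerBr scalerA -ofRM divff ?gt_eqF// ofR1 scale1r.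
split=> [/cvg_nrmP H e e0|H].
  near=> h; have h0 : 0 < h by near: h; exact: nbhs_right_gt.
  rewrite E// nrmZR gtr0_norm// mulrC ler_pM2r//; apply: ltW.
  by near: h; exact: H.
apply/cvg_nrmP => e e0; have e2 : 0 < e / 2 by rewrite divr_gt0.
near=> h; have h0 : 0 < h by near: h; exact: nbhs_right_gt.
apply: (@le_lt_trans _ _ (e / 2)); last by lra.
rewrite -(ler_pM2r h0) mulrC -{1}(gtr0_norm h0) -nrmZR -E//.
by near: h; exact: H.
Unshelve. all: by end_near. Qed.

Lemma domain_intro x y :
  (forall e : R, 0 < e -> \forall h \near 0^'+, nrm (T h x - x - ofR h *: y) <= e * h) ->
  DA x.
Proof. by move=> /difference_quotientP H; apply/Agen.1/cvg_ex; exists y. Qed.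

Lemma generator_expansion x : DA x -> forall e : R, 0 < e ->
  \forall h \near 0^'+, nrm (T h x - x - ofR h *: A x) <= e * h.
Proof. by move=> /(Agen.2 x)/difference_quotientP. Qed.

Section Dense.
Variable b0 : X -> X -> R.
Hypothesis b0_coercive : coercive_hform b0.
Hypothesis b0_nrm : forall x, b0 x x = nrm x ^+ 2.
Let fb0 : hform b0 := proj1 b0_coercive.

Let C x y : continuous (fun s => b0 (orbit T x s) y).
Proof. exact: (continuous_hform_orbitl semigroup T_le). Qed.

Let le_sq (z : X) (c : R) : 0 <= c -> b0 z z <= c * nrm z -> nrm z <= c.
Proof.
move=> c0; rewrite b0_nrm expr2; have [->//|z0] := eqVneq (nrm z) 0.
by rewrite ler_pM2r// lt_def z0 nrm_ge0.
Qed.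

(* Replacing the orbit by a constant vector u in a weak integral costs at most
   the distance of the orbit to u. *)
Let area_dev x u z (a c e : R) : 0 <= a -> a <= c -> 0 <= e ->
  (forall s, a <= s <= c -> nrm (orbit T x s - u) <= e) ->
  `|area (fun s => b0 (orbit T x s) z) a c - (c - a) * b0 u z| <= e * nrm z * (c - a).
Proof.
move=> a0 ac e0 H.
have cst : continuous (fun _ : R => b0 u z) by move=> s; exact: cvg_cst.
have -> : area (fun s => b0 (orbit T x s) z) a c - (c - a) * b0 u z =
    area (fun s => 1 * b0 (orbit T x s) z + (-1) * b0 u z) a c.
  rewrite (area_lin 1 (-1) (@C x z) cst a0 ac).
  have [d _ ->] := area_mean cst a0 ac; ring.
apply: area_norm_le => // [s|s sac].
  by apply: cvgD; apply: cvgM; [exact: cvg_cst|exact: C|exact: cvg_cst|exact: cvg_cst].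
rewrite mul1r mulN1r -(hformBl fb0) (le_trans (inner_CS b0_coercive b0_nrm _ _))//.
by rewrite ler_wpM2r ?nrm_ge0// H.
Qed.

Lemma weak_integral x (t : R) : 0 <= t ->
  exists v, forall y, b0 v y = area (fun s => b0 (orbit T x s) y) 0 t.
Proof.
move=> t0; apply: (@riesz _ _ _ _ _ (`|M * nrm x * t|)) => //.
- move=> y z; rewrite -[area _ _ _ in X in _ = X + _]mul1r -[area _ _ _ in X in _ = _ + X]mul1r.
  rewrite -area_lin//; congr area; apply/funext => s.
  by rewrite (hformDr fb0) !mul1r.
- move=> r y; have := area_lin r 0 (@C x y) (@C x y) (lexx 0) t0; rewrite mul0r addr0 => <-.
  by congr area; apply/funext => s; rewrite (hformZRr fb0) mul0r addr0.
move=> y; apply: le_trans (ler_norm _) _.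
apply: (@le_trans _ _ (M * nrm x * nrm y * (t - 0))).
  apply: area_norm_le => // s /andP[s0 _]; rewrite orbitE//.
  by rewrite (le_trans (inner_CS b0_coercive b0_nrm _ _))// ler_wpM2r ?nrm_ge0// T_le.
by rewrite subr0 mulrAC ler_wpM2r ?nrm_ge0// ler_norm.
Qed.

(** For v the integral of the orbit over [0, t], T h v - v is the integral over
[t, t + h] minus the integral over [0, h]; divided by h this tends to
T t x - x. The differences are tested against z, the remainder itself. *)
Lemma weak_integral_domain x v (t : R) : 0 <= t ->
  (forall y, b0 v y = area (fun s => b0 (orbit T x s) y) 0 t) -> DA v.
Proof.
move=> t0 vE; apply: (@domain_intro v (T t x - x)) => e e0.
have e2 : 0 < e / 2 by rewrite divr_gt0.
have [d d0 H] := orbit_modulus semigroup T_le x e2.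
near=> h; have h0 : 0 < h by near: h; exact: nbhs_right_gt.
have hd : h < d by near: h; exact: nbhs_right_lt.
set z := T h v - v - _.
have hE y : b0 (T h v) y = area (fun s => b0 (orbit T x s) y) h (t + h).
  (* w is the adjoint of T h applied to y. *)
  have [w wE] : exists w, forall u, b0 w u = b0 (T h u) y.
    apply: (@riesz _ _ _ _ _ (`|M * nrm y|)) => //.
    - by move=> u1 u2; rewrite linearD (hformDl fb0).
    - by move=> r u; rewrite linearZ /= (hformZRl fb0).
    move=> u; rewrite (le_trans (ler_norm _))//.
    rewrite (le_trans (inner_CS b0_coercive b0_nrm _ _))//.
    apply: (@le_trans _ _ (M * nrm u * nrm y)); first by rewrite ler_wpM2r ?nrm_ge0// T_le ?ltW.
    by rewrite mulrAC ler_wpM2r ?nrm_ge0// ler_norm.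
  rewrite -wE (hformC fb0) vE -[X in area _ X (t + h)]add0r -(area_shift (@C x y) (lexx _) t0 (ltW h0)).
  apply: eq_area => //.
    move=> s; apply: (@continuous_comp _ _ _ (fun u => u + h) (fun s => b0 (orbit T x s) y)); last exact: C.
    by apply: cvgD; [exact: cvg_id|exact: cvg_cst].
  move=> s s0; rewrite (hformC fb0) wE !orbitE ?addr_ge0 ?(ltW h0)//.
  by rewrite (addrC s) TD ?(ltW h0).
have ht : 0 <= t + h by rewrite addr_ge0// ltW.
apply: le_sq; first by rewrite mulr_ge0 ?ltW.
have zz : b0 z z = (area (fun s => b0 (orbit T x s) z) t (t + h) - (t + h - t) * b0 (T t x) z)
    - (area (fun s => b0 (orbit T x s) z) 0 h - (h - 0) * b0 x z).
  rewrite {1}/z !(hformBl fb0) (hformZRl fb0) !(hformBl fb0) hE vE.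
  have := area_cat (fun s => b0 (orbit T x s) z) 0 h (t + h).
  have := area_cat (fun s => b0 (orbit T x s) z) 0 t (t + h).
  by move=> E1 E2; rewrite E1 in E2; lra.
have d1 := @area_dev x (T t x) z t (t + h) (e / 2) t0 _ (ltW e2) _.
have d2 := @area_dev x x z 0 h (e / 2) (lexx _) (ltW h0) (ltW e2) _.
rewrite zz (le_trans (ler_norm _))// (le_trans (ler_normB _ _))//.
apply: le_trans (lerD (d1 _ _) (d2 _)) _.
- by rewrite lerDl ltW.
- move=> s /andP[ts sth]; have s0 := le_trans t0 ts.
  rewrite orbitE//; apply/ltW/H => //; rewrite ger0_norm ?subr_ge0//.
  by apply: le_lt_trans hd; lra.
- move=> s /andP[s0 sh]; rewrite orbitE//.
  apply/ltW; move: (H s 0 s0 (lexx _)).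
  have -> : T 0 x = x by case: semigroup.
  by apply; rewrite subr0 ger0_norm// (le_lt_trans sh).
by rewrite le_eqVlt; apply/orP; left; apply/eqP; field.
Unshelve. all: by end_near. Qed.

(** The averages v / t of the orbit over [0, t] lie in the domain and tend to x
as t tends to 0. *)
Theorem domain_dense x (e : R) : 0 < e -> exists2 z, DA z & nrm (z - x) < e.
Proof.
move=> e0; have e2 : 0 < e / 2 by rewrite divr_gt0.
have [d d0 H] := orbit_modulus semigroup T_le x e2.
pose t := d / 2; have t0 : 0 < t by rewrite divr_gt0.
have td : t < d by rewrite /t; lra.
have [v vE] := weak_integral x (ltW t0).
have Dv := weak_integral_domain (ltW t0) vE.
have fd (u : X) : DA u -> forall r : R, DA (ofR r *: u).
  move=> Du r; apply: (@domain_intro _ (ofR r *: A u)) => e' e'0.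
  have r1 : 0 < `|r| + 1 by rewrite ltr_wpDl.
  near=> h; have h0 : 0 < h by near: h; exact: nbhs_right_gt.
  have -> : T h (ofR r *: u) - ofR r *: u - ofR h *: (ofR r *: A u) =
      ofR r *: (T h u - u - ofR h *: A u).
    by rewrite linearZ !scalerBr !scalerA -!ofRM (mulrC r).
  rewrite nrmZR.
  apply: (@le_trans _ _ (`|r| * (e' / (`|r| + 1) * h))).
    rewrite ler_wpM2l//; near: h; exact: generator_expansion Du _ (divr_gt0 e'0 r1).
  rewrite mulrA ler_pM2r// mulrCA ler_piMr ?ltW// ltr_pdivrMr// mul1r ltrDl//.
exists (ofR t^-1 *: v); first exact: fd.
apply: (@le_lt_trans _ _ (e / 2)); last by lra.
have -> : ofR t^-1 *: v - x = ofR t^-1 *: (v - ofR t *: x).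
  by rewrite scalerBr scalerA -ofRM mulVf ?gt_eqF// ofR1 scale1r.
rewrite nrmZR gtr0_norm ?invr_gt0// mulrC ler_pdivrMr//.
apply: le_sq; first by rewrite mulr_ge0 ?ltW.
rewrite {1}(hformBl fb0) vE (hformZRl fb0).
have := @area_dev x x (v - ofR t *: x) 0 t (e / 2) (lexx _) (ltW t0) (ltW e2) _.
rewrite subr0 => h; apply: le_trans (ler_norm _) _; apply: le_trans (h _) _.
  move=> s /andP[s0 st]; rewrite orbitE//.
  have := H s 0 s0 (lexx _); have -> : T 0 x = x by case: semigroup.
  by move=> hh; apply/ltW/hh; rewrite subr0 ger0_norm// (le_lt_trans st).
by rewrite mulrAC.
Unshelve. all: by end_near. Qed.

End Dense.

(** T s carries the first-order expansion of the orbit of x to that of T s x. *)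
Lemma generator_orbit x (s : R) : DA x -> 0 <= s ->
  DA (T s x) /\ A (T s x) = T s (A x).
Proof.
move=> Dx s0.
have H e : 0 < e -> \forall h \near 0^'+,
    nrm (T h (T s x) - T s x - ofR h *: T s (A x)) <= e * h.
  move=> e0; have M1 : 0 < `|M| + 1 by rewrite ltr_wpDl.
  near=> h; have h0 : 0 < h by near: h; exact: nbhs_right_gt.
  have -> : T h (T s x) - T s x - ofR h *: T s (A x) = T s (T h x - x - ofR h *: A x).
    by rewrite !(linearB (T s)) [T s (ofR h *: _)]linearZ /= -!TD ?(ltW h0)// (addrC s).
  rewrite (le_trans (T_le _ s0))//.
  apply: (@le_trans _ _ ((`|M| + 1) * (e / (`|M| + 1) * h))); last first.
    by rewrite mulrA mulrCA divff ?mulr1// gt_eqF.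
  apply: (@le_trans _ _ ((`|M| + 1) * nrm (T h x - x - ofR h *: A x))).
    by rewrite ler_wpM2r ?nrm_ge0// (le_trans (ler_norm _))// lerDl.
  rewrite ler_pM2l//.
  near: h; exact: generator_expansion Dx _ (divr_gt0 e0 M1).
have Ds := domain_intro H; split=> //.
apply: (@cvg_unique _ (@norm_hausdorff _ X) (ofR h^-1 *: (T h (T s x) - T s x) @[h --> 0^'+])).
  exact: Agen.2.
exact/difference_quotientP.
Unshelve. all: by end_near. Qed.

(** With z = T s x one has T h z = z + h A z + r, where |r| <= e1 h uniformly in
s because r is the image under T s of the remainder at x. The first-order term
2 h b (A z) z is nonpositive by dissipativity. *)
Lemma dissipative_step (b : X -> X -> R) x : hform b ->
  (forall z, DA z -> b (A z) z <= 0) -> DA x -> forall e : R, 0 < e ->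
  \forall h \near 0^'+, forall s, 0 <= s ->
    b (T (s + h) x) (T (s + h) x) <= b (T s x) (T s x) + h * e.
Proof.
move=> fb diss Dx e e0; have [K [K0 Kb]] := hform_bounded fb.
have M1 : 0 < `|M| + 1 by rewrite ltr_wpDl.
pose M' := `|M| + 1; pose Z := M' * nrm x; pose Y := M' * nrm (A x).
have Z0 : 0 <= Z by rewrite mulr_ge0 ?nrm_ge0// ltW.
have Y0 : 0 <= Y by rewrite mulr_ge0 ?nrm_ge0// ltW.
have TM t u : 0 <= t -> nrm (T t u) <= M' * nrm u.
  move=> t0; rewrite (le_trans (T_le _ t0))// ler_wpM2r ?nrm_ge0//.
  by rewrite (le_trans (ler_norm _))// lerDl.
have KZ : 0 < 4 * K * Z + 2 by rewrite ltr_wpDl// mulr_ge0// mulr_ge0// ltW.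
pose e1 := e / (4 * K * Z + 2); have e10 : 0 < e1 by rewrite divr_gt0.
have e1E : 2 * K * Z * e1 <= e / 2.
  have : e1 * (4 * K * Z + 2) = e by rewrite divfK// gt_eqF.
  lra.
pose L := K * (Y + e1) ^+ 2 + 1.
have L0 : 0 < L by rewrite ltr_wpDl// mulr_ge0 ?sqr_ge0// ltW.
near=> h; have h0 : 0 < h by near: h; exact: nbhs_right_gt.
have hL : h * L <= e / 2.
  rewrite -ler_pdivlMr//; near: h; apply: nbhs_right_le.
  by rewrite !divr_gt0.
have hr : nrm (T h x - x - ofR h *: A x) <= e1 / M' * h.
  by near: h; exact: generator_expansion Dx _ (divr_gt0 e10 M1).
move=> s s0; have [Ds AE] := generator_orbit Dx s0.
set z := T s x; set a := T s (A x).
pose r := T s (T h x - x - ofR h *: A x).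
have rle : nrm r <= e1 * h.
  rewrite (le_trans (TM _ _ s0))// (le_trans (ler_wpM2l (ltW M1) hr))//.
  by rewrite mulrA [M' * _]mulrC divfK// gt_eqF.
have zle : nrm z <= Z by exact: TM.
have ale : nrm a <= Y by exact: TM.
have ba : b a z <= 0 by rewrite /a -AE; exact: diss.
have -> : T (s + h) x = z + (ofR h *: a + r).
  rewrite /r !(linearB (T s)) [T s (ofR h *: _)]linearZ /= -/z -/a TD ?(ltW h0)//.
  by rewrite addrA addrC addrACA addNr addr0 subrK.
set w := _ + r.
have wle : nrm w <= h * (Y + e1).
  rewrite (le_trans (nrmD _ _))// nrmZR gtr0_norm// mulrDr lerD//.
    by rewrite ler_pM2l.
  by rewrite mulrC.
have bww : b w w <= h * (h * (K * (Y + e1) ^+ 2)).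
  rewrite (le_trans (ler_norm _))// (le_trans (Kb _ _))//.
  have : K * nrm w * nrm w <= K * (h * (Y + e1)) * (h * (Y + e1)).
    by rewrite ler_pM ?mulr_ge0 ?nrm_ge0 ?(ltW K0)// ler_pM2l.
  by congr (_ <= _); ring.
have bzr : b z r <= K * Z * (e1 * h).
  rewrite (le_trans (ler_norm _))// (le_trans (Kb _ _))//.
  by rewrite ler_pM ?mulr_ge0 ?nrm_ge0 ?(ltW K0)// ler_pM2l.
have hba : h * b a z <= 0 by rewrite pmulr_rle0.
have hL' : h * (h * (K * (Y + e1) ^+ 2)) <= h * (e / 2).
  rewrite ler_pM2l//; apply: le_trans hL; rewrite ler_pM2l// lerDl//.
have hE : h * (2 * K * Z * e1) <= h * (e / 2) by rewrite ler_pM2l.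
have -> : b (z + w) (z + w) = b z z + 2 * (h * b a z) + 2 * b z r + b w w.
  rewrite (hformDl fb) !(hformDr fb) (hformC fb w z) /w (hformDr fb z) (hformZRr fb) (hformC fb z a).
  ring.
lra.
Unshelve. all: by end_near. Qed.

(** Summing [dissipative_step] over n steps of length t / n handles the domain,
and density extends the inequality to X. *)
Theorem dissipative_contraction (b0 b : X -> X -> R) : coercive_hform b0 ->
  (forall x, b0 x x = nrm x ^+ 2) -> hform b -> (forall x, 0 <= b x x) ->
  (forall z, DA z -> b (A z) z <= 0) ->
  forall t x, 0 <= t -> b (T t x) (T t x) <= b x x.
Proof.
move=> cb0 b0n fb b_ge0 diss t x.
rewrite le_eqVlt => /predU1P[<-|t0].
  by have -> : T 0 x = x by case: semigroup.
have dom z : DA z -> b (T t z) (T t z) <= b z z.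
  move=> Dz; apply/ler_addgt0Pr => e e0.
  have et : 0 < e / t by rewrite divr_gt0.
  have [d /= d0 H] := dissipative_step fb diss Dz et.
  have [N HN] := invS_lt (divr_gt0 d0 t0).
  pose h := t * N.+1%:R^-1.
  have h0 : 0 < h by rewrite mulr_gt0// invr_gt0.
  have hd : h < d by rewrite /h mulrC -ltr_pdivlMr// HN.
  have chain n : b (T (n%:R * h) z) (T (n%:R * h) z) <= b z z + n%:R * h * (e / t).
    elim: n => [|n IH].
      by rewrite !mul0r addr0; have -> : T 0 z = z by case: semigroup.
    have := H h; rewrite /= sub0r normrN gtr0_norm// => /(_ hd h0 (n%:R * h)).
    rewrite (mulr_ge0 (ler0n _ _) (ltW h0)) => /(_ isT).
    rewrite -natr1 mulrDl mul1r; lra.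
  have := chain N.+1; have -> : N.+1%:R * h = t.
    by rewrite mulrCA divff ?mulr1// pnatr_eq0.
  by rewrite [t * _]mulrC divfK// gt_eqF.
pose N u := Num.sqrt (b u u).
have ND u v : N (u + v) <= N u + N v by exact: hform_sqrt_triangle.
have N0 u : 0 <= N u by exact: sqrtr_ge0.
have [K [K0 Kb]] := hform_bounded fb.
have NK u : N u <= Num.sqrt K * nrm u.
  have nE : nrm u = Num.sqrt (nrm u ^+ 2) by rewrite sqrtr_sqr ger0_norm// nrm_ge0.
  rewrite nE -sqrtrM ?(ltW K0)// ler_wsqrtr// (le_trans (ler_norm _))//.
  by rewrite expr2 mulrA.
suff : N (T t x) <= N x.
  by rewrite /N ler_sqrt.
apply/ler_addgt0Pr => e e0.
pose L := Num.sqrt K * (`|M| + 2).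
have L0 : 0 < L by rewrite mulr_gt0 ?sqrtr_gt0// ltr_wpDl.
have [z Dz zx] := domain_dense cb0 b0n x (divr_gt0 e0 L0).
have tz : N (T t z) <= N z by rewrite /N ler_sqrt// dom.
have h1 : N (T t x) <= N (T t z) + N (T t (x - z)).
  by have := ND (T t z) (T t (x - z)); rewrite linearB [_ + (_ - _)]addrC subrK.
have h2 : N z <= N x + N (z - x) by have := ND x (z - x); rewrite [_ + (_ - _)]addrC subrK.
have h3 := NK (z - x); have h4 := NK (T t (x - z)).
have h5 : nrm (T t (x - z)) <= (`|M| + 1) * nrm (z - x).
  rewrite (le_trans (T_le _ (ltW t0)))// nrmC ler_wpM2r ?nrm_ge0//.
  by rewrite (le_trans (ler_norm _))// lerDl.
have h6 : Num.sqrt K * nrm (T t (x - z)) <= Num.sqrt K * ((`|M| + 1) * nrm (z - x)).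
  by rewrite ler_wpM2l// sqrtr_ge0.
move: zx; rewrite ltr_pdivlMr// /L; lra.
Qed.

End Generator.

(** * Scalar products as coercive forms *)

Section ScalarProducts.
Context {R : realType} {k : scalars} {X : normedModType (sfield R k)}.
Implicit Type ip : {dot X for (@conjs R k)}.

Lemma dotC ip x y : ip x y = conjs (ip y x).
Proof. by rewrite (hermitian_subproof (s := ip)) expr0 mul1r. Qed.

Lemma dotZl ip a x y : ip (a *: x) y = a * ip x y.
Proof. by rewrite linearZl_LR. Qed.

Lemma dotZr ip a x y : ip x (a *: y) = conjs a * ip x y.
Proof. by rewrite dotC dotZl conjsM -dotC. Qed.

Lemma dotDl ip x y z : ip (x + y) z = ip x z + ip y z.
Proof. by rewrite linearDl. Qed.

Lemma re_dot_ge0 ip x : 0 <= re (ip x x).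
Proof.
have [->|x0] := eqVneq x 0; first by rewrite linear0l re0.
have p : 0 < ip x x by exact: neq0_dnorm_gt0.
by rewrite -(@ler_ofR R k) ofR0 -real_ofR ?ltW// gtr0_real.
Qed.

(** Equivalence of norms yields the two-sided bounds; the bound on the mixed
terms then follows from Cauchy-Schwarz. *)
Lemma dot_coercive ip : norm_equiv (fun x => Num.sqrt (re (ip x x))) ->
  coercive_hform (fun x y => re (ip x y)).
Proof.
move=> [c [C [c0 C0 H]]].
pose b x y := re (ip x y).
have bC x y : b x y = b y x by rewrite /b dotC re_conjs.
have bD x y z : b (x + y) z = b x z + b y z by rewrite /b dotDl reD.
have bZ (r : R) x y : b (ofR r *: x) y = r * b x y by rewrite /b dotZl re_ofRM.
have bsq x : Num.sqrt (b x x) ^+ 2 = b x x by rewrite sqr_sqrtr// re_dot_ge0.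
have le_sq (u v : R) : 0 <= u -> u <= v -> u ^+ 2 <= v ^+ 2.
  by move=> u0 uv; rewrite ler_sqr ?nnegrE// (le_trans u0).
have bounds x : c ^+ 2 * nrm x ^+ 2 <= b x x <= C ^+ 2 * nrm x ^+ 2.
  have /andP[h1 h2] := H x; rewrite -bsq -!exprMn !le_sq ?sqrtr_ge0//.
  by rewrite mulr_ge0 ?nrm_ge0// ltW.
split; last by exists (c ^+ 2); rewrite exprn_gt0//; split=> // x; have /andP[] := bounds x.
split=> // [a x y|]; first by rewrite dotZl dotZr conjsK.
exists (C ^+ 2); rewrite exprn_gt0//; split=> // x y.
have CS : b x y ^+ 2 <= b x x * b y y.
  apply: discriminant_le => t.
  have := re_dot_ge0 ip (x + ofR t *: y); rewrite -/(b _ _) bD bZ.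
  rewrite (bC x) (bC y (x + _)) !bD !bZ (bC y x).
  by congr (0 <= _); ring.
have h0 : 0 <= C ^+ 2 * nrm x * nrm y by rewrite mulr_ge0 ?nrm_ge0// mulr_ge0 ?nrm_ge0// sqr_ge0.
rewrite -ler_sqr ?nnegrE// real_normK ?num_real//.
rewrite (le_trans CS)//.
have /andP[_ hx] := bounds x; have /andP[_ hy] := bounds y.
rewrite (le_trans (ler_pM (re_dot_ge0 _ _) (re_dot_ge0 _ _) hx hy))//.
by rewrite le_eqVlt; apply/orP; left; apply/eqP; ring.
Qed.

Lemma re_dot_nrm ip : induces_norm ip -> forall x, re (ip x x) = nrm x ^+ 2.
Proof. by move=> H x; rewrite H -ofR_nrm expr2 re_ofRM ofRK -expr2. Qed.

Lemma inner_coercive ip : induces_norm ip -> coercive_hform (fun x y => re (ip x y)).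
Proof.
move=> H; apply: dot_coercive; exists 1, 1; split=> // x.
by rewrite (re_dot_nrm H) sqrtr_sqr ger0_norm ?nrm_ge0// mul1r lexx.
Qed.

(** Self-adjointness of P makes <P x, x> real, so that its positivity can be
read off its real part b x x. *)
Lemma dot_of_hform ip (P : {linear X -> X}) (b : X -> X -> R) : coercive_hform b ->
  (forall x y, ip (P x) y = ip x (P y)) -> (forall x y, re (ip (P x) y) = b x y) ->
  exists ipn : {dot X for (@conjs R k)}, forall x y, ipn x y = ip (P x) y.
Proof.
move=> [fb [c [c0 cb]]] Psym PE; pose f x y := ip (P x) y.
have fNr x y : f x (- y) = - f x y.
  by rewrite /f -scaleN1r dotZr conjsN -ofR1 conjs_ofR ofR1 mulN1r.
have fDr x y z : f x (y + z) = f x y + f x z.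
  by rewrite /f (dotC _ (P x)) dotDl conjsD -!dotC.
have fBl z : {morph f^~ z : x y / x - y} by move=> x y; rewrite /f linearB linearBl.
have fBr x : {morph f x : y z / y - z} by move=> y z; rewrite fDr fNr.
have fZl z : scalable_for *%R (f ^~ z) by move=> a x; rewrite /f linearZ dotZl.
have fZr x : scalable_for (conjs \; *%R) (f x) by move=> a y; rewrite /f dotZr.
have fh x y : f x y = (-1) ^+ false * conjs (f y x).
  by rewrite expr0 mul1r /f -dotC Psym.
have fp x : x != 0 -> 0 < f x x.
  move=> x0; rewrite (_ : f x x = ofR (b x x)).
    by rewrite -ofR0 ltr_ofR (lt_le_trans _ (cb x))// mulr_gt0 ?exprn_gt0 ?nrm_gt0.
  rewrite -PE; apply: conjs_fixed_real; by rewrite -dotC -Psym.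
pose m1 := isBilinear.Build _ _ _ _ *%R (conjs \; *%R) f fBl fBr fZl fZr.
pose m2 := isHermitianSesquilinear.Build _ X false conjs f fh.
pose m3 := isDotProduct.Build _ X f fp.
by exists (HB.pack f m1 m2 m3 : {dot X for (@conjs R k)}).
Qed.

End ScalarProducts.

(** Riesz provides the operator; its self-adjointness is recovered from real
parts by testing against all multiples of x. *)
Lemma quadratic_of_hform {R : realType} {k : scalars} {X : completeNormedModType (sfield R k)}
    (ip : {dot X for (@conjs R k)}) (b : X -> X -> R) :
  induces_norm ip -> hform b -> quadratic ip (fun x => b x x).
Proof.
move=> ipn fb; have cb0 := inner_coercive ipn; have fb0 := proj1 cb0.
have [P [Pb PE]] := hform_operator cb0 fb; rewrite /= in PE.
have Psym x y : ip (P x) y = ip x (P y).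
  apply: scalar_eq_re => a; rewrite -!dotZl -linearZ PE (hformC fb) -PE dotC re_conjs.
  by [].
exists P; split=> // x; rewrite -PE; apply: conjs_fixed_real.
by rewrite -dotC -Psym.
Qed.

(** * Decay under inputs *)

Lemma class_Kinfty_sq {R : realType} (c : R) : 0 < c -> class_Kinfty (fun r : R => c * r ^+ 2).
Proof.
move=> c0; split.
- apply: continuous_subspaceT => r; apply: cvgM; first exact: cvg_cst.
  by apply: cvgM; exact: cvg_id.
- move=> r s; rewrite !in_itv/= !andbT => r0 s0 rs.
  by rewrite ltr_pM2l// ltr_sqr ?nnegrE.
- by rewrite expr0n mulr0.
apply/cvgryPge => A; near=> r.
have r1 : 1 <= r by near: r; apply: nbhs_pinfty_ge; rewrite num_real.
have rA : A / c <= r by near: r; apply: nbhs_pinfty_ge; rewrite num_real.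
rewrite ler_pdivrMr// in rA; apply: (le_trans rA).
by rewrite mulrC ler_pM2l// expr2 ler_peMr// (le_trans _ r1).
Unshelve. all: by end_near. Qed.

Section MildSolution.
Context {R : realType} {k : scalars} {X U : completeNormedModType (sfield R k)}.
Variable T : R -> {linear X -> X}.
Variable M : R.
Hypothesis T_le : forall (t : R) x, 0 <= t -> nrm (T t x) <= M * nrm x.
Local Notation mu := (@lebesgue_measure R).

Lemma lebesgue_measure_itv0_lty (t : R) : (mu `]0%R, t[%classic < +oo)%E.
Proof. by rewrite lebesgue_measure_itv /=; case: ifP => // _; rewrite -EFinB ltry. Qed.

Lemma mild_solution_unforced (B : U -> X) (u : R -> U) t x :
  (forall s, B (u s) = 0) -> mild_solution T B t x u = T t x.
Proof.
move=> Bu; rewrite /mild_solution [X in _ + X](_ : _ = 0) ?addr0//.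
apply: nrm_eq0; apply/eqP; rewrite eq_le nrm_ge0 andbT.
rewrite -[leRHS](mul0r (fine (mu `]0, t[%classic))); apply: nrm_bochner_le => //.
  exact: lebesgue_measure_itv0_lty.
by apply/nearW => s _; rewrite Bu linear0 nrm0.
Qed.

Variable B : {linear U -> X}.
Variable beta : R.
Hypothesis B_le : forall y, nrm (B y) <= beta * nrm y.

Lemma input_term_le (u : R -> U) (h r : R) : 0 <= M -> 0 <= beta -> 0 < h -> 0 <= r ->
  {ae mu, forall s, `]0, h[%classic s -> nrm (u s) <= r} ->
  nrm (mild_solution T B h 0 u) <= M * beta * r * h.
Proof.
move=> M0 b0 h0 r0 ur; rewrite /mild_solution linear0 add0r.
have mE : fine (mu `]0, h[%classic) = h.
  by rewrite lebesgue_measure_itv /= lte_fin h0 -EFinB subr0.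
rewrite -[X in _ <= _ * X]mE; apply: nrm_bochner_le => //.
- exact: lebesgue_measure_itv0_lty.
- by rewrite !mulr_ge0.
apply: negligibleS ur => s /= nH H; apply: nH => sh; have := sh; rewrite /= in_itv/= => /andP[_ sh'].
rewrite (le_trans (T_le _ _)) ?subr_ge0 ?(ltW sh')// -!mulrA ler_wpM2l//.
by rewrite (le_trans (B_le _))// ler_wpM2l// H.
Qed.

Lemma mild_solutionE (u : R -> U) h x :
  mild_solution T B h x u = T h x + mild_solution T B h 0 u.
Proof. by rewrite /mild_solution linear0 add0r. Qed.

Variable N : X -> R.
Variable K : R.
Hypothesis ND : forall x y, N (x + y) <= N x + N y.
Hypothesis N_bounds : forall x, 0 <= N x <= K * nrm x.

(** Write T h x + w for the mild solution, with |w| <= M beta (r + e') h. As N is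
a seminorm bounded by K times the norm, N (T h x + w)^2 exceeds N (T h x)^2 by
at most 2 S |x| (r + e') h + O(h^2), where S = K^2 M (M beta). Young's
inequality splits 2 S |x| r into a |x|^2 / 2, absorbed by the decay, and
2 S^2 r^2 / a. The summand 1 keeps the gain positive when S = 0. *)
Lemma dini_forced (a : R) (u : R -> U) (r : R) x : 0 <= M -> 0 <= beta -> 0 <= K ->
  0 < a -> 0 <= r ->
  (dini (fun h => N (T h x) ^+ 2)%R (N x ^+ 2)%R <= (- (a * nrm x ^+ 2))%:E)%E ->
  (forall e, 0 < e -> \forall h \near 0^'+,
     {ae mu, forall s, `]0, h[%classic s -> nrm (u s) <= r + e}) ->
  (Vdot T B (fun y => N y ^+ 2)%R u x
    <= (- (a / 2 * nrm x ^+ 2) + (2 * (K ^+ 2 * M * (M * beta)) ^+ 2 / a + 1) * r ^+ 2)%:E)%E.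
Proof.
move=> M0 b0 K0 a0 r0 /dini_le D H; apply/dini_le => e e0.
pose C := M * beta; pose n := nrm x; pose S := K ^+ 2 * M * C.
have C0 : 0 <= C by rewrite mulr_ge0.
have n0 : 0 <= n by exact: nrm_ge0.
have S0 : 0 <= S by rewrite !mulr_ge0// sqr_ge0.
have Sn : 0 < 2 * (1 + 2 * S * n) by rewrite mulr_gt0// ltr_wpDr// mulr_ge0// mulr_ge0.
pose e' := e / (2 * (1 + 2 * S * n)).
have e'0 : 0 < e' by rewrite divr_gt0.
have e'E : e' * (1 + 2 * S * n) = e / 2 by rewrite /e'; field; lra.
pose L := (K * C * (r + e')) ^+ 2 + 1.
have L0 : 0 < L by rewrite ltr_wpDl// sqr_ge0.
near=> h; have h0 : 0 < h by near: h; exact: nbhs_right_gt.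
have hL : h * L <= e / 2.
  rewrite -ler_pdivlMr//; near: h; apply: nbhs_right_le.
  by rewrite !divr_gt0.
have hD : N (T h x) ^+ 2 - N x ^+ 2 <= h * (- (a * n ^+ 2) + e') by near: h; exact: D.
rewrite mild_solutionE; set w := mild_solution T B h 0 u.
have wle : nrm w <= C * (r + e') * h.
  apply: input_term_le => //; first by rewrite addr_ge0// ltW.
  by near: h; exact: H.
have Nw : N w <= K * C * (r + e') * h.
  have /andP[_ h1] := N_bounds w; rewrite (le_trans h1)//.
  by rewrite -!mulrA ler_wpM2l// !mulrA.
have Ny : N (T h x) <= K * (M * n).
  have /andP[_ h1] := N_bounds (T h x); rewrite (le_trans h1)// ler_wpM2l// T_le// ltW.
have Ny0 : 0 <= N (T h x) by have /andP[] := N_bounds (T h x).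
have Nw0 : 0 <= N w by have /andP[] := N_bounds w.
have Nyw : N (T h x + w) ^+ 2 <= (N (T h x) + N w) ^+ 2.
  by rewrite ler_sqr ?nnegrE ?addr_ge0//; have /andP[] := N_bounds (T h x + w).
have c1 : N (T h x) * N w <= K * (M * n) * (K * C * (r + e') * h) by rewrite ler_pM.
have c2 : N w ^+ 2 <= h * (h * (K * C * (r + e')) ^+ 2).
  have := ler_pM Nw0 Nw0 Nw Nw; rewrite -expr2 => /le_trans; apply.
  by rewrite le_eqVlt; apply/orP; left; apply/eqP; ring.
have c3 : h * (h * (K * C * (r + e')) ^+ 2) <= h * (e / 2).
  by rewrite ler_pM2l// (le_trans _ hL)// ler_pM2l// lerDl.
have young : 2 * S * n * r <= a / 2 * n ^+ 2 + 2 * S ^+ 2 / a * r ^+ 2.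
  rewrite -subr_ge0 (_ : _ - _ = a / 2 * (n - 2 * S * r / a) ^+ 2); last first.
    by field; rewrite gt_eqF.
  by rewrite mulr_ge0 ?sqr_ge0// divr_ge0// ltW.
have hy : h * (2 * S * n * r) <= h * (a / 2 * n ^+ 2 + 2 * S ^+ 2 / a * r ^+ 2).
  by rewrite ler_pM2l.
have he : h * (e' * (1 + 2 * S * n)) = h * (e / 2) by rewrite e'E.
have hr : 0 <= h * r ^+ 2 by rewrite mulr_ge0 ?sqr_ge0// ltW.
rewrite -/n -/C -/S.
have c1' : 2 * (N (T h x) * N w) <= h * (2 * S * n * r) + h * (2 * S * n * e').
  apply: (@le_trans _ _ (2 * (K * (M * n) * (K * C * (r + e') * h)))).
    by rewrite ler_pM2l.
  by rewrite le_eqVlt; apply/orP; left; apply/eqP; rewrite /S; ring.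
move: (2 * S ^+ 2 / a) hy => Q hy.
rewrite sqrrD in Nyw.
lra.
Unshelve. all: by end_near. Qed.

End MildSolution.

(** * The implications *)

Section Implications.
Context {R : realType} {k : scalars} {X U : completeNormedModType (sfield R k)}.
Variable ip : {dot X for (@conjs R k)}.
Hypothesis Xhilbert : induces_norm ip.
Variable B : {linear U -> X}.
Hypothesis Bbounded : bounded_op B.
Variable T : R -> {linear X -> X}.
Hypothesis Tsemigroup : C0_semigroup T.
Hypothesis Tstable : exponentially_stable T.
Variables (DA : set X) (A : X -> X).
Hypothesis Agen : generates DA A T.

Let b0 x y := re (ip x y).
Let cb0 : coercive_hform b0 := inner_coercive Xhilbert.
Let fb0 : hform b0 := proj1 cb0.
Let b0_nrm x : b0 x x = nrm x ^+ 2 := re_dot_nrm Xhilbert x.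

Lemma stable_bounded : exists2 M, 0 < M & forall t x, 0 <= t -> nrm (T t x) <= M * nrm x.
Proof.
have [M [w [M0 w0 H]]] := Tstable; exists M => // t x t0.
rewrite (le_trans (H t t0 x))// ler_wpM2r ?nrm_ge0// ler_piMr ?(ltW M0)//.
by rewrite -expR0 ler_expR oppr_le0 mulr_ge0// ltW.
Qed.

Lemma coercive_L2_ISS_unforced :
  (exists V : X -> R, L2_ISS_quadratic_Lyapunov T B V /\ L2_coercive V) ->
  exists V : X -> R,
    [/\ ISS_Lyapunov T (fun _ : U => 0) V, coercive V & quadratic ip V].
Proof.
move=> [V [[cV [F [Fb _ VF]] [al2 [_ Vpos]] [a3 [a4 [a30 _ Vdec]]]] [a1 [a2 [a10 a20 Vb]]]]].
exists V; split; last 2 first.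
- exists (fun r => a1 * r ^+ 2); split; first exact: class_Kinfty_sq.
  by move=> x; have /andP[] := Vb x.
- have -> : V = fun x => b0 (F x) (F x) by apply/funext => x; rewrite VF b0_nrm.
  exact: (quadratic_of_hform Xhilbert (hform_comp Fb fb0)).
split=> // [x|]; first by rewrite VF sqr_ge0.
exists (fun r => a2 * r ^+ 2), (fun r => a3 * r ^+ 2), (fun r => 1 * r ^+ 2).
split; try exact: class_Kinfty_sq.
  by move=> x x0; have /andP[-> _] := Vpos x x0; have /andP[] := Vb x.
move=> x u _.
have := Vdec x (fun _ => 0) (continuous_subspaceT (@cst_continuous _ _ _)).
rewrite nrm0 expr0n mulr0 addr0 /Vdot.
under eq_fun do rewrite mild_solution_unforced ?linear0//.
under [in X in _ -> X]eq_fun do rewrite mild_solution_unforced//.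
by move=> /le_trans; apply; rewrite lee_fin lerDl mul1r sqr_ge0.
Qed.

(** The right derivative of b (T h x) (T h x) at 0 is 2 b (A x) x, as the limit of
b q (T h x) + b x q for the difference quotient q. *)
Lemma dissipative_of_decay (b : X -> X -> R) x : hform b -> DA x ->
  (dini (fun h => b (T h x) (T h x)) (b x x) <= 0%:E)%E -> b (A x) x <= 0.
Proof.
move=> fb Dx /dini_le H; have [_ _ _ /(_ x) Tx] := Tsemigroup.
have qx := Agen.2 x Dx.
have L : (b (ofR h^-1 *: (T h x - x)) (T h x) + b x (ofR h^-1 *: (T h x - x))) @[h --> 0^'+]
    --> b (A x) x + b x (A x).
  by apply: cvgD; apply: hform_cvg => //; exact: cvg_cst.
rewrite leNgt; apply/negP => bpos.
have e0 : 0 < b (A x) x by [].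
have L' : b (A x) x < b (A x) x + b x (A x) by rewrite (hformC fb x) ltrDl.
have N1 := cvgr_gt _ L _ L'; have N2 := H _ e0; have N3 := nbhs_right_gt (0 : R).
have [h [[h1 h2] h0]] := filter_ex (filterI (filterI (N1 _) N2) N3).
move: h1 h2; rewrite (hformZRl fb) (hformZRr fb) -mulrDr mulrC ltr_pdivlMr//.
by rewrite (hformBl fb) (hformBr fb) add0r; lra.
Qed.

(** Since V (r x) = r^2 V x, comparison functions of class K-infinity matter
only through their values at 1, and become quadratic. *)
Lemma coercive_unforced_dissipative :
  (exists V : X -> R,
    [/\ ISS_Lyapunov T (fun _ : U => 0) V, coercive V & quadratic ip V]) ->
  exists ipn : {dot X for (@conjs R k)},
    [/\ equivalent_scalar_product ipn, dissipative ipn DA A,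
        ISS_Lyapunov T B (fun x => re (ipn x x)) &
        quadratic ip (fun x => re (ipn x x))].
Proof.
move=> [V [[cV V0 [al2 [al3 [sg [_ [_ m3 a30 _] [_ _ s0 _] Vpos Vdec]]]]]
  [al1 [[_ m1 a10 _] Vlow]] [P [Pb Psym PV]]]].
have VE x : V x = re (ip (P x) x) by rewrite PV ofRK.
pose b x y := re (ip (P x) y).
have [MP [MP0 PM]] := (proj1 (bounded_opP _) Pb).
have fb : hform b.
  split=> [x y|x y z|a x y|r x y|].
  - by rewrite /b Psym dotC re_conjs.
  - by rewrite /b linearD dotDl reD.
  - by rewrite /b linearZ /= dotZl dotZr conjsK.
  - by rewrite /b linearZ /= dotZl re_ofRM.
  exists MP; split=> // x y.
  by rewrite (le_trans (inner_CS cb0 b0_nrm _ _))// ler_wpM2r ?nrm_ge0.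
have Vsc (r : R) x : V (ofR r *: x) = r ^+ 2 * V x.
  by rewrite !VE -!/(b _ _) (hformZRl fb) (hformZRr fb) mulrA.
have in1 r : 0 <= r -> r \in `[0 : R, +oo[ by rewrite in_itv/= andbT.
have c0 : 0 < al1 1 by rewrite -a10 m1// in1.
have a0 : 0 < al3 1 by rewrite -a30 m3// in1.
have unit x : x != 0 -> nrm (ofR (nrm x)^-1 *: x) = 1.
  by move=> /nrm_gt0 n0; rewrite nrmZR gtr0_norm ?invr_gt0// mulVf// gt_eqF.
have cb : coercive_hform b.
  split=> //; exists (al1 1); split=> // x.
  have [->|x0] := eqVneq x 0; first by rewrite nrm0 expr0n mulr0 (hform0l fb).
  have := Vlow (ofR (nrm x)^-1 *: x); rewrite unit// Vsc VE.
  by rewrite exprVn mulrC ler_pdivlMr// exprn_gt0// nrm_gt0.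
have dec x : (dini (fun h => V (T h x)) (V x) <= (- (al3 1 * nrm x ^+ 2))%:E)%E.
  have [->|x0] := eqVneq x 0.
    apply/dini_le => e e0; near=> h; have h0 : 0 < h by near: h; exact: nbhs_right_gt.
    rewrite linear0 subrr nrm0 expr0n mulr0 oppr0 add0r.
    by rewrite mulr_ge0 ?ltW.
  have n0 := nrm_gt0 x0.
  have := Vdec (ofR (nrm x)^-1 *: x) (fun _ => 0) (@Linfty_loc0 _ _ _).
  rewrite Linfty_norm0_cst0 s0 addr0 unit// /Vdot.
  under eq_fun do rewrite mild_solution_unforced// linearZ /= Vsc.
  move=> /dini_le D; apply/dini_le => e e0.
  have e1 : 0 < e / nrm x ^+ 2 by rewrite divr_gt0// exprn_gt0.
  have := D _ e1; apply: filterS => h; rewrite Vsc -mulrBr exprVn mulrC ler_pdivrMr ?exprn_gt0//.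
  move=> /le_trans; apply; rewrite le_eqVlt; apply/orP; left; apply/eqP; field.
  by rewrite gt_eqF.
have [ipn ipnE] := dot_of_hform cb Psym (fun _ _ => erefl).
have nE : (fun x => re (ipn x x)) = V by apply/funext => x; rewrite ipnE VE.
have bE : (fun x => Num.sqrt (re (ipn x x))) = fun x => Num.sqrt (b x x).
  by apply/funext => x; rewrite ipnE.
exists ipn; rewrite nE; split; last 2 first.
- split=> //; have [M M0 TM] := stable_bounded.
  have [be [be0 BM]] := proj1 (bounded_opP _) Bbounded.
  pose N x := Num.sqrt (b x x).
  have N2 x : N x ^+ 2 = V x by rewrite sqr_sqrtr ?VE// coercive_hform_ge0.
  have [c [K [cc0 K0 HK]]] := hform_sqrt_bounds cb.
  have NK x : 0 <= N x <= K * nrm x by rewrite sqrtr_ge0/=; have /andP[] := HK x.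
  exists (fun r => K ^+ 2 * r ^+ 2), (fun r => al3 1 / 2 * r ^+ 2),
    (fun r => (2 * (K ^+ 2 * M * (M * be)) ^+ 2 / al3 1 + 1) * r ^+ 2).
  split.
  + by apply: class_Kinfty_sq; rewrite exprn_gt0.
  + by apply: class_Kinfty_sq; rewrite divr_gt0.
  + apply: class_Kinfty_sq; rewrite ltr_wpDl//.
    by rewrite divr_ge0 ?(ltW a0)// mulr_ge0 ?sqr_ge0.
  + move=> x x0; have /andP[-> _] := Vpos x x0; rewrite /= -N2 -exprMn.
    have /andP[h1 h2] := NK x; rewrite ler_sqr ?nnegrE//.
    exact: mulr_ge0 (ltW K0) (nrm_ge0 x).
  move=> x u uloc; rewrite (_ : V = fun y => N y ^+ 2); last by apply/funext => y; rewrite N2.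
  have ND y z : N (y + z) <= N y + N z.
    by apply: hform_sqrt_triangle => //; exact: coercive_hform_ge0.
  apply: (dini_forced TM BM ND NK (ltW M0) (ltW be0) (ltW K0) a0 (Linfty_norm0_ge0 u)).
  + by under eq_fun do rewrite N2; rewrite N2.
  + by move=> e e0; exact: Linfty_near.
- by exists P.
- by rewrite /equivalent_scalar_product bE; exact: hform_sqrt_bounds.
move=> x Dx; rewrite ipnE; apply: (dissipative_of_decay fb Dx).
have := dec x; rewrite VE; under eq_fun do rewrite VE.
by move=> /le_trans; apply; rewrite lee_fin oppr_le0 mulr_ge0 ?sqr_ge0 ?ltW.
Unshelve. all: by end_near. Qed.

(** The similarity is the square root of the new scalar product: it maps the
new norm isometrically to the original one. *)
Lemma dissipative_similar :
  (exists ipn : {dot X for (@conjs R k)},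
      equivalent_scalar_product ipn /\ dissipative ipn DA A) ->
  similar_to_contraction T.
Proof.
move=> [ipn [eqn diss]]; have [M M0 TM] := stable_bounded.
have cb := dot_coercive eqn; set b := (fun x y => _) in cb.
have [S [S' [Sb S'b SK S'K SE]]] := hform_square_root cb0 b0_nrm cb.
have contr := dissipative_contraction Tsemigroup TM Agen cb0 b0_nrm (proj1 cb)
  (coercive_hform_ge0 cb) diss.
have [MS [MS0 SM]] := proj1 (bounded_opP _) Sb.
have [MS' [MS'0 S'M]] := proj1 (bounded_opP _) S'b.
have [_ T0 TD Tc] := Tsemigroup.
exists S, S'; split=> //; split; last first.
  move=> t t0 x /=; rewrite -ler_sqr ?nnegrE ?nrm_ge0//.
  by rewrite SE (le_trans (contr _ _ t0))// -SE S'K.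
split.
- move=> t t0; apply/bounded_opP; exists (MS * (M * MS')); split; first by rewrite !mulr_gt0.
  move=> x /=; rewrite (le_trans (SM _))// -!mulrA ler_wpM2l ?(ltW MS0)//.
  by rewrite (le_trans (TM _ _ t0))// ler_wpM2l ?(ltW M0).
- by move=> x /=; rewrite T0 S'K.
- by move=> t s t0 s0 x /=; rewrite TD// SK.
move=> x; apply/cvg_nrmP => e e0; have /cvg_nrmP /(_ _ (divr_gt0 e0 MS0)) := Tc (S' x).
apply: filterS => t; rewrite ltr_pdivlMr// mulrC; apply: le_lt_trans => /=.
by rewrite -{2}(S'K x) -linearB.
Qed.

(** The form |S x|^2 + integral of |T s x|^2 over [0, tau] decays at rate
|x|^2 / 2, and W is the norm it induces. *)
Lemma similar_decay : similar_to_contraction T ->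
  exists (F : {linear X -> X}) (W : X -> R) (a : R),
    [/\ bounded_op F, forall x, W x = nrm (F x), equivalent_norm W, 0 < a &
        forall x, (dini (fun h => W (T h x)) (W x) <= (- (a * W x))%:E)%E].
Proof.
move=> [S [S' [Sb S'b SK S'K [_ contr]]]].
have [M M0 TM] := stable_bounded.
have [M1 [w [M10 w0 Texp]]] := Tstable.
(* exp (w tau) >= 1 + w tau > 2 M1 makes T tau a contraction by 1/2. *)
pose tau := 2 * M1 / w.
have tau0 : 0 < tau by rewrite divr_gt0// mulr_gt0.
have Ttau x : nrm (T tau x) ^+ 2 <= 2^-1 * nrm x ^+ 2.
  have h : nrm (T tau x) <= 2^-1 * nrm x.
    rewrite (le_trans (Texp _ (ltW tau0) x))// ler_wpM2r ?nrm_ge0//.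
    rewrite expRN ler_pdivrMr ?expR_gt0//.
    have := expR_ge1Dx (w * tau); rewrite {1}/tau mulrCA divff ?gt_eqF// mulr1.
    lra.
  have n0 := nrm_ge0 x; have := ler_pM (nrm_ge0 _) (nrm_ge0 _) h h.
  rewrite -!expr2 exprMn => /le_trans; apply; rewrite ler_wpM2r ?sqr_ge0//; lra.
pose g x y (s : R) := b0 (orbit T x s) (orbit T y s).
pose b x y := b0 (S x) (S y) + area (g x y) 0 tau.
have farea : hform (fun x y => area (g x y) 0 tau).
  exact: (hform_area Tsemigroup TM fb0 (ltW tau0)).
have fS : hform (fun x y => b0 (S x) (S y)) by exact: hform_comp.
have fb : hform b by exact: hformD.
have cg x y : continuous (g x y) by exact: (continuous_hform_orbit Tsemigroup TM).
have [MS' [MS'0 S'M]] := proj1 (bounded_opP _) S'b.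
have cb : coercive_hform b.
  split=> //; exists (MS' ^- 2); rewrite invr_gt0 exprn_gt0//; split=> // x.
  apply: (@le_trans _ _ (nrm (S x) ^+ 2)).
    rewrite mulrC ler_pdivrMr ?exprn_gt0// -exprMn ler_sqr ?nnegrE ?mulr_ge0 ?nrm_ge0 ?(ltW MS'0)//.
    by rewrite -{1}(SK x) mulrC.
  rewrite /b b0_nrm lerDl; apply: area_ge0 => //; first exact: ltW.
  by move=> s _; rewrite /g b0_nrm sqr_ge0.
have Sdec h x : 0 <= h -> nrm (S (T h x)) <= nrm (S x).
  by move=> h0; have := contr h h0 (S x); rewrite /= SK.
have [F [F' [Fb _ _ _ FE]]] := hform_square_root cb0 b0_nrm cb.
have Vdec x e : 0 < e -> \forall h \near 0^'+,
    b (T h x) (T h x) - b x x <= h * (- (2^-1 * nrm x ^+ 2) + e).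
  move=> e0; have e2 : 0 < e / 2 by rewrite divr_gt0.
  near=> h; have h0 : 0 < h by near: h; exact: nbhs_right_gt.
  have d0 : `|area (g x x) 0 (0 + h) - h * g x x 0| <= h * (e / 2).
    by near: h; exact: area_right.
  have d1 : `|area (g x x) tau (tau + h) - h * g x x tau| <= h * (e / 2).
    by near: h; apply: area_right => //; exact: ltW.
  have sh : area (g (T h x) (T h x)) 0 tau = area (g x x) h (tau + h).
    exact: (area_orbit_shift Tsemigroup TM _ _ fb0 (ltW h0) (ltW tau0)).
  have gt : h * g x x tau <= h * (2^-1 * nrm x ^+ 2).
    by rewrite ler_pM2l// /g b0_nrm orbitE ?Ttau// ltW.
  have g0 : g x x 0 = nrm x ^+ 2.
    by rewrite /g b0_nrm orbitE//; have [_ -> _ _] := Tsemigroup.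
  have hS : nrm (S (T h x)) ^+ 2 <= nrm (S x) ^+ 2.
    by rewrite ler_sqr ?nnegrE ?nrm_ge0// Sdec// ltW.
  rewrite /b sh !b0_nrm; move: d0; rewrite g0 add0r => d0.
  have := area_cat (g x x) 0 h (tau + h).
  have := area_cat (g x x) 0 tau (tau + h).
  move: d0 d1; rewrite !ler_norml => /andP[d0 _] /andP[_ d1] E1 E2.
  rewrite E1 in E2; lra.
have [K [K0 Kb]] := hform_bounded fb.
pose W x := nrm (F x).
have W2 x : W x ^+ 2 <= K * nrm x ^+ 2.
  by rewrite /W FE (le_trans (ler_norm _))// (le_trans (Kb _ _))// -mulrA -expr2.
have Wn x : W x = Num.sqrt (b x x) by rewrite -FE sqrtr_sqr ger0_norm// nrm_ge0.
have [c [C [c0 C0 cC]]] := hform_sqrt_bounds cb.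
exists F, W, (4 * K)^-1; split=> //.
- split.
  + by move=> x y; rewrite /W linearD nrmD.
  + by move=> a x; rewrite /W linearZ /= nrmZ.
  by exists c, C; split=> // x; rewrite Wn.
- by rewrite invr_gt0 mulr_gt0.
move=> x; apply/dini_le => e e0.
have [->|x0] := eqVneq x 0.
  near=> h; have h0 : 0 < h by near: h; exact: nbhs_right_gt.
  by rewrite /W !linear0 nrm0 subrr mulr0 oppr0 add0r mulr_ge0 ?ltW.
have Wx : 0 < W x.
  by have /andP[h _] := cC x; rewrite Wn; apply: lt_le_trans h; rewrite mulr_gt0 ?nrm_gt0.
near=> h; have h0 : 0 < h by near: h; exact: nbhs_right_gt.
have VD : b (T h x) (T h x) - b x x <= h * (- (2^-1 * nrm x ^+ 2) + e * W x).
  by near: h; apply: Vdec; rewrite mulr_gt0.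
(* Passing from V = W^2 to W: 2 q (p - q) <= p^2 - q^2. *)
have young : 2 * W x * (W (T h x) - W x) <= W (T h x) ^+ 2 - W x ^+ 2.
  by rewrite -subr_ge0 (_ : _ - _ = (W (T h x) - W x) ^+ 2) ?sqr_ge0//; ring.
have W2E y : W y ^+ 2 = b y y by exact: FE.
rewrite !W2E in young.
have W2' : (2 * K)^-1 * W x ^+ 2 <= 2^-1 * nrm x ^+ 2.
  by rewrite invfM -mulrA ler_pM2l ?invr_gt0// mulrC ler_pdivrMr// mulrC.
have hW : h * ((2 * K)^-1 * W x ^+ 2) <= h * (2^-1 * nrm x ^+ 2) by rewrite ler_pM2l.
have eW : 0 <= h * (e * W x) by rewrite !mulr_ge0 ?ltW.
have W20 : 0 < 2 * W x by rewrite mulr_gt0.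
rewrite -(ler_pM2l W20).
have -> : 2 * W x * (h * (- ((4 * K)^-1 * W x) + e)) =
    - (h * ((2 * K)^-1 * W x ^+ 2)) + 2 * (h * (e * W x)).
  by field; rewrite gt_eqF.
lra.
Unshelve. all: by end_near. Qed.

(** For V = W^2 the rate is 2 a W^2 >= 2 a c^2 |x|^2 by norm equivalence; the
square of the increment of W is of second order in h. *)
Lemma decay_coercive_L2_ISS :
  (exists (F : {linear X -> X}) (W : X -> R) (a : R),
    [/\ bounded_op F, forall x, W x = nrm (F x), equivalent_norm W, 0 < a &
        forall x, (dini (fun h => W (T h x)) (W x) <= (- (a * W x))%:E)%E]) ->
  exists V : X -> R, L2_ISS_quadratic_Lyapunov T B V /\ L2_coercive V.
Proof.
move=> [F [W [a [Fb WF [WD _ [c [C [c0 C0 cC]]]] a0 Wdec]]]].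
have W0 x : 0 <= W x by rewrite WF nrm_ge0.
have bnd x : c ^+ 2 * nrm x ^+ 2 <= W x ^+ 2 <= C ^+ 2 * nrm x ^+ 2.
  have /andP[h1 h2] := cC x.
  by rewrite -!exprMn !ler_sqr ?nnegrE ?mulr_ge0 ?nrm_ge0 ?h1 ?h2// ?ltW.
have Vpos x : x != 0 -> 0 < W x ^+ 2.
  move=> x0; have /andP[h _] := bnd x; apply: lt_le_trans h.
  by rewrite mulr_gt0// exprn_gt0// nrm_gt0.
have [M M0 TM] := stable_bounded.
have [be [be0 BM]] := proj1 (bounded_opP _) Bbounded.
pose a' := 2 * a * c ^+ 2.
have a'0 : 0 < a' by rewrite !mulr_gt0// exprn_gt0.
exists (fun x => W x ^+ 2); split; last first.
  by exists (c ^+ 2), (C ^+ 2); rewrite !exprn_gt0.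
split.
- have -> : (fun x => W x ^+ 2) = (fun x => b0 (F x) (F x)).
    by apply/funext => x; rewrite WF b0_nrm.
  by move=> x; apply: hform_cvg => //; exact: bounded_linear_continuous.
- exists F; split=> // [x y E|x]; last by rewrite WF.
  apply/eqP; rewrite -subr_eq0; apply/negP => /negP /Vpos.
  by rewrite WF linearB E subrr nrm0 expr0n ltxx.
- exists (fun r => C ^+ 2 * r ^+ 2); split; first by apply: class_Kinfty_sq; rewrite exprn_gt0.
  by move=> x x0; rewrite Vpos//; have /andP[] := bnd x.
exists (a' / 2), (2 * (C ^+ 2 * M * (M * be)) ^+ 2 / a' + 1); split.
- by rewrite divr_gt0.
- by rewrite ltr_wpDl// divr_ge0 ?(ltW a'0)// mulr_ge0 ?sqr_ge0.
have WC y : 0 <= W y <= C * nrm y by rewrite W0; have /andP[] := cC y.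
move=> x u cu.
apply: (dini_forced TM BM WD WC (ltW M0) (ltW be0) (ltW C0) a'0 (nrm_ge0 (u 0))).
- apply/dini_le => e e0.
  pose q := W x; have q0 : 0 <= q by exact: W0.
  pose e' := e / (2 * (2 * q + 1)).
  have Q0 : 0 < 2 * (2 * q + 1) by rewrite mulr_gt0// ltr_wpDl// mulr_ge0.
  have e'0 : 0 < e' by rewrite divr_gt0.
  have e'E : e' * (2 * (2 * q + 1)) = e by rewrite divfK// gt_eqF.
  have e2 : 0 < e / 2 by rewrite divr_gt0.
  pose L := (- (a * q) + e') ^+ 2 + 1.
  have L0 : 0 < L by rewrite ltr_wpDl// sqr_ge0.
  have /dini_le /(_ _ e'0) D := Wdec x.
  near=> h; have h0 : 0 < h by near: h; exact: nbhs_right_gt.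
  have hL : h * L <= e / 2.
    by rewrite -ler_pdivlMr//; near: h; apply: nbhs_right_le; rewrite divr_gt0.
  have hD : W (T h x) - q <= h * (- (a * q) + e') by near: h; exact: D.
  have hsq : W (T h x) ^+ 2 <= (q + h * (- (a * q) + e')) ^+ 2.
    have Wle : W (T h x) <= q + h * (- (a * q) + e') by rewrite -lerBlDl.
    by rewrite ler_sqr ?nnegrE// (le_trans (W0 _) Wle).
  have hc : h * (h * (- (a * q) + e') ^+ 2) <= h * (e / 2).
    by rewrite ler_pM2l// (le_trans _ hL)// ler_pM2l// lerDl.
  have he : h * (e' * (2 * (2 * q + 1))) = h * e by rewrite e'E.
  have he' : 0 <= h * e' by rewrite mulr_ge0 ?ltW.
  have hb : h * a * (c ^+ 2 * nrm x ^+ 2) <= h * a * q ^+ 2.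
    by rewrite ler_pM2l ?mulr_gt0//; have /andP[] := bnd x.
  rewrite -/q /a'; lra.
move=> e e0.
have [_ /cvg_nrmP /(_ _ e0) [d /= d0 H]] := proj1 (continuous_within_itvcyP _ _) cu.
near=> h; have hd : h < d by near: h; exact: nbhs_right_lt.
apply/nearW => s; rewrite /= in_itv/= => /andP[s0 sh].
rewrite -[u s](subrK (u 0)) (le_trans (nrmD _ _))// addrC lerD2l ltW//.
by apply: H => //=; rewrite sub0r normrN gtr0_norm// (lt_trans sh).
Unshelve. all: by end_near. Qed.

End Implications.

Theorem theorem1 (R : realType) (k : scalars)
    (X U : completeNormedModType (sfield R k))
    (ip : {dot X for (@conjs R k)}) (Xhilbert : induces_norm ip)
    (B : {linear U -> X}) (Bbounded : bounded_op B)
    (T : R -> {linear X -> X}) (Tsemigroup : C0_semigroup T)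
    (Tstable : exponentially_stable T)
    (DA : set X) (A : X -> X) (Agen : generates DA A T) :
  [<->
    (* (i) *)
    exists V : X -> R, L2_ISS_quadratic_Lyapunov T B V /\ L2_coercive V;
    (* (ii) *)
    exists V : X -> R,
      [/\ ISS_Lyapunov T (fun _ : U => 0) V, coercive V & quadratic ip V];
    (* (iii) *)
    exists ipn : {dot X for (@conjs R k)},
      [/\ equivalent_scalar_product ipn, dissipative ipn DA A,
          ISS_Lyapunov T B (fun x => re (ipn x x)) &
          quadratic ip (fun x => re (ipn x x))];
    (* (iv) *)
    exists ipn : {dot X for (@conjs R k)},
      equivalent_scalar_product ipn /\ dissipative ipn DA A;
    (* (v) *)
    similar_to_contraction T;
    (* (vi) *)
    exists (F : {linear X -> X}) (W : X -> R) (a : R),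
      [/\ bounded_op F, forall x, W x = nrm (F x), equivalent_norm W, 0 < a &
          forall x, (dini (fun h => W (T h x)) (W x) <= (- (a * W x))%:E)%E]].
Proof.
tfae.
- exact: coercive_L2_ISS_unforced.
- exact: coercive_unforced_dissipative.
- by move=> [ipn [? ? _ _]]; exists ipn.
- exact: dissipative_similar.
- exact: similar_decay.
- exact: decay_coercive_L2_ISS.
Qed.
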